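(* There exists a finite inverse temperature $\beta^*$ such that for every $\beta$ with $\infty\geq\beta>\beta^*$ the following holds. Let $\nu$ be a translation invariant EA$_\beta$ spin glass distribution on $\mathbb Z^2$ (for $\beta=\infty$: a translation invariant ground state). Then $\nu$-almost surely every connected component of the subgraph of $(\mathbb Z^2)^*$ formed by the unsatisfied dual edges is finite.
   Context: $\mathbb Z^2$ is the square lattice (edges between vertices at $\ell_1$-distance $1$); $(\mathbb Z^2)^*=(\tfrac12,\tfrac12)+\mathbb Z^2$ is its dual, each dual edge $e^*$ being identified with the unique edge $e$ of $\mathbb Z^2$ crossing it. Interactions are $w:E(\mathbb Z^2)\to\mathbb R$; spins are $\sigma:\mathbb Z^2\to\{-1,+1\}$. For a finite subgraph $C$, let $C^c$ be the subgraph on $\mathbb Z^2\setminus V(C)$, $\partial C^c$ the vertices of $C^c$ having a neighbour in $C$, and $\bar C=C\cup\partial C^c$. For boundary conditions $\tau\in\{\pm1\}^{V(\partial C^c)}$, let $\Omega^{C,\tau}$ be the spin configurations on $\bar C$ agreeing with $\tau$ on $\partial C^c$, $\mathcal H^{C,\tau}_w(\sigma)=-\sum w_{xy}\sigma_x\sigma_y$ (sum over neighbouring pairs $x,y\in V(\bar C)$), and $\mathbb P^{C,\tau}_{w,\beta}(\sigma)\propto\exp(-\beta\mathcal H^{C,\tau}_w(\sigma))$ on $\Omega^{C,\tau}$. An EA$_\beta$ spin glass distribution ($0\le\beta<\infty$) is a joint law of $(w,\sigma)$ such that $(w_e)$ are i.i.d. standard normal and, for every finite subgraph $C$, the conditional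 law of $\sigma_{\bar C}$ given $\sigma_{C^c}$ and $w$ is $\mathbb P^{C,\sigma_{\partial C^c}}_{w,\beta}$. A ground state is a joint law of $(w,\sigma)$ with $w$ i.i.d. standard normal such that a.s., for every finite $C$, $\sigma_C$ is the unique minimizer of $\mathcal H^{C,\tau}_w$ given $\tau=\sigma_{\partial C^c}$. Translation invariance refers to the diagonal action of $\mathbb Z^2$ translations on $(w,\sigma)$. An edge $e=\{i,j\}$ and its dual $e^*$ are unsatisfied if $w_e\sigma_i\sigma_j<0$. *)

(* Defs.v *)
From HB Require Import structures.
From mathcomp Require Import all_boot all_order all_algebra.
From mathcomp Require Import all_classical all_reals all_analysis.
From Stdlib Require Import Relations.Relation_Operators.
Import numFieldNormedType.Exports.
Import Order.TTheory GRing.Theory Num.Theory.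
Local Open Scope classical_set_scope.
Local Open Scope ring_scope.

Definition Z2 := (int * int)%type.
Definition vadd (x t : Z2) : Z2 := (x.1 + t.1, x.2 + t.2).
Definition unitv (d : bool) : Z2 := if d then (1, 0) else (0, 1).
(* Edges of Z^2 are encoded as (x, d), the edge {x, x + unitv d};
   this is a bijection between Z2 * bool and E(Z^2). *)
Definition edge_end (x : Z2) (d : bool) : Z2 := vadd x (unitv d).

Definition nbrs (x : Z2) : seq Z2 :=
  [:: vadd x (1, 0); vadd x (-1, 0); vadd x (0, 1); vadd x (0, -1)].

(* A configuration: interactions w (on edges) and spins sigma
   (true = +1, false = -1). *)
Definition Config (R : realType) := ((Z2 -> bool -> R) * (Z2 -> bool))%type.
Definition spin (R : realType) (b : bool) : R := if b then 1 else -1.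

(* Finite subgraph C, given by its (finite) vertex set, a list.
   Cbar C = V(C) together with the outer boundary dC^c. *)
Definition Cbar (C : seq Z2) : seq Z2 := undup (C ++ flatten (map nbrs C)).

Definition hamiltonian (R : realType) (C : seq Z2) (w : Z2 -> bool -> R)
    (s : Z2 -> bool) : R :=
  - \sum_(x <- Cbar C) \sum_(d : bool)
      (if edge_end x d \in Cbar C then w x d * spin R (s x) * spin R (s (edge_end x d))
       else 0).

Definition glue (C : seq Z2) (eta : {ffun seq_sub C -> bool}) (s : Z2 -> bool)
  : Z2 -> bool :=
  fun x => match insub x with Some y => eta y | None => s x end.

Definition restr (C : seq Z2) (s : Z2 -> bool) : {ffun seq_sub C -> bool} :=
  [ffun y => s (val y)].

(* Finite-volume Gibbs probability P^{C,tau}_{w,beta}(eta), tau = s on dC^c. *)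
Definition gibbs (R : realType) (beta : R) (C : seq Z2) (w : Z2 -> bool -> R)
    (s : Z2 -> bool) (eta : {ffun seq_sub C -> bool}) : R :=
  expR (- beta * hamiltonian R C w (glue C eta s)) /
  \sum_(eta' : {ffun seq_sub C -> bool})
     expR (- beta * hamiltonian R C w (glue C eta' s)).

Definition cyl_w (R : realType) : set (set (Config R)) :=
  [set A | exists x d (B : set R), measurable B /\ A = [set c | B (c.1 x d)]].
Definition cyl_s_out (R : realType) (C : seq Z2) : set (set (Config R)) :=
  [set A | exists x b, x \notin C /\ A = [set c : Config R | c.2 x = b]].
Definition cylinders (R : realType) : set (set (Config R)) :=
  @cyl_w R `|` [set A | exists x b, A = [set c : Config R | c.2 x = b]].

Definition ConfigSpace (R : realType) := g_sigma_algebraType (@cylinders R).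
HB.instance Definition _ (R : realType) := Measurable.on (ConfigSpace R).

Definition outer_sigma (R : realType) (C : seq Z2) : set (set (Config R)) :=
  <<s @cyl_w R `|` @cyl_s_out R C >>.

Definition iid_std_normal (R : realType)
    (nu : probability (ConfigSpace R) R) : Prop :=
  forall (es : seq (Z2 * bool)) (B : Z2 * bool -> set R),
    uniq es -> (forall e, measurable (B e)) ->
    nu [set c : ConfigSpace R | forall e, e \in es -> B e (c.1 e.1 e.2)] =
    (\prod_(e <- es) normal_prob 0 1 (B e))%E.

Definition shift (R : realType) (t : Z2) (c : Config R) : Config R :=
  (fun x d => c.1 (vadd x t) d, fun x => c.2 (vadd x t)).

Definition translation_invariant (R : realType)
    (nu : probability (ConfigSpace R) R) : Prop :=
  forall (t : Z2) (A : set (ConfigSpace R)), measurable A ->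
    nu (shift R t @^-1` A) = nu A.

Definition EA_spin_glass (R : realType) (beta : R)
    (nu : probability (ConfigSpace R) R) : Prop :=
  iid_std_normal R nu /\
  forall (C : seq Z2) (eta : {ffun seq_sub C -> bool}) (F : set (ConfigSpace R)),
    @outer_sigma R C F ->
    nu (F `&` [set c | restr C c.2 = eta]) =
    (\int[nu]_(c in F) (gibbs R beta C c.1 c.2 eta)%:E)%E.

Definition ground_state (R : realType) (nu : probability (ConfigSpace R) R)
  : Prop :=
  iid_std_normal R nu /\
  {ae nu, forall c : ConfigSpace R, forall (C : seq Z2)
      (eta : {ffun seq_sub C -> bool}), eta != restr C c.2 ->
      hamiltonian R C c.1 c.2 < hamiltonian R C c.1 (glue C eta c.2)}.

(* Unsatisfied edges and the dual graph.  Dual vertex u = (a,b) stands for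
   (a+1/2, b+1/2).  Edge (x, true) = {(a,b),(a+1,b)} is crossed by the dual
   edge {(a,b-1),(a,b)}; edge (x,false) = {(a,b),(a,b+1)} is crossed by the
   dual edge {(a-1,b),(a,b)}. *)
Definition unsatisfied (R : realType) (c : Config R) (x : Z2) (d : bool) : Prop :=
  c.1 x d * spin R (c.2 x) * spin R (c.2 (edge_end x d)) < 0.

Definition dual_other_end (x : Z2) (d : bool) : Z2 :=
  if d then vadd x (0, -1) else vadd x (-1, 0).

Definition unsat_dual_adj (R : realType) (c : Config R) (u v : Z2) : Prop :=
  exists x d, unsatisfied R c x d /\
    ((u = x /\ v = dual_other_end x d) \/ (v = x /\ u = dual_other_end x d)).

Definition unsat_conn (R : realType) (c : Config R) : Z2 -> Z2 -> Prop :=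
  clos_refl_trans Z2 (unsat_dual_adj R c).

Definition all_unsat_clusters_finite (R : realType) (c : Config R) : Prop :=
  forall u : Z2, finite_set [set v | unsat_conn R c u v].

(* Main.v *)
(* Fix a dual path of n edges and flip the signs of the couplings it crosses.
   Reversing an unsatisfied coupling only increases the Gibbs weight of a spin
   configuration, and each configuration makes the path unsatisfied for exactly
   one of the 2^n sign patterns, so for a fixed boundary condition the path is
   unsatisfied with probability at most 2^-n, even given all the |w_e|.

   Entropy is killed by a geodesic property.  If an unsatisfied path is longer,
   for the first-passage lengths |w_e|, than another path with the same ends,
   flipping the region between the two lowers the energy.  Cut the path into
   segments of 64 steps.  A segment that is the strictly shortest among the
   64-step paths with its end points is determined by these; every other segment
   has either a competitor of almost the same length, an event of small
   probability by anticoncentration, or a competitor shorter by [a], which costs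
   a factor exp(-2 beta a).  Far apart segments do not interact, hence an
   unsatisfied path of n steps has probability exponentially small in n, also
   simultaneously in many disjoint boxes.

   The boundary spins may depend on the couplings in an unknown way, so one takes
   a union bound over all boundary conditions of a large square.  By translation
   invariance, if infinite clusters had positive probability, then a positive
   fraction of the area of the square would start long unsatisfied paths, and
   this exponential cost in the area beats the factor 2^(perimeter). *)
Require Import Defs.
From HB Require Import structures.
From mathcomp Require Import all_boot all_order all_algebra.
From mathcomp Require Import all_classical all_reals all_analysis measurable_realfun.
From mathcomp Require Import zify ring lra.
From Stdlib Require Import Relations.Relation_Operators.
Import Order.TTheory GRing.Theory Num.Theory.
Import numFieldNormedType.Exports.
Local Open Scope classical_set_scope.
Local Open Scope ring_scope.

(** * Dual paths *)

Notation edge := (Z2 * bool)%type.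
Notation dir := (bool * bool)%type.

(* A step [(d, b)] crosses a primal edge of orientation [d]: it is vertical when
   [d] is true, and forward when [b] is. *)
Definition dstep (u : Z2) (s : dir) : Z2 :=
  if s.2 then vadd u (if s.1 then (0, 1) else (1, 0)) else dual_other_end u s.1.
(** A dual edge is named by the primal edge [(x, d)] that it crosses, and [x] is then also the label
    of its upper or right end. A forward step ends at this label, a backward step starts from it. *)
Definition dedge (u : Z2) (s : dir) : edge := (if s.2 then dstep u s else u, s.1).
Fixpoint wedges (u : Z2) (ws : seq dir) : seq edge :=
  if ws is s :: ws' then dedge u s :: wedges (dstep u s) ws' else [::].
Definition wend (u : Z2) (ws : seq dir) : Z2 := foldl dstep u ws.
(* The starting point [u] is not listed. *)
Definition wpos (u : Z2) (ws : seq dir) : seq Z2 := scanl dstep u ws.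
Definition saw (u : Z2) (ws : seq dir) : bool := uniq (u :: wpos u ws).

Definition near (n : nat) (u v : Z2) : bool :=
  (`|v.1 - u.1| <= n%:Z) && (`|v.2 - u.2| <= n%:Z).

Lemma near_refl n u : near n u u.
Proof. by rewrite /near !subrr normr0. Qed.

Lemma near_trans n m u v t : near n u v -> near m v t -> near (n + m) u t.
Proof. rewrite /near; lia. Qed.

Lemma near_sym n u v : near n u v = near n v u.
Proof. rewrite /near; lia. Qed.

Lemma near_leq n m u v : (n <= m)%N -> near n u v -> near m u v.
Proof. rewrite /near; lia. Qed.

Lemma near_dstep u s : near 1 u (dstep u s).
Proof. by case: u s => a b [[] []]; rewrite /near /dstep /=; lia. Qed.

Lemma near_dedge u s : near 1 u (dedge u s).1.
Proof. by rewrite /dedge; case: ifP => _; [apply: near_dstep|apply: near_refl]. Qed.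

Lemma size_wedges u ws : size (wedges u ws) = size ws.
Proof. by elim: ws u => //= s ws IH u; rewrite IH. Qed.

Lemma wend_cat u a b : wend u (a ++ b) = wend (wend u a) b.
Proof. by rewrite /wend foldl_cat. Qed.

Lemma wedges_cat u a b : wedges u (a ++ b) = wedges u a ++ wedges (wend u a) b.
Proof. by elim: a u => //= s a IH u; rewrite IH. Qed.

Lemma wpos_cat u a b : wpos u (a ++ b) = wpos u a ++ wpos (wend u a) b.
Proof. by rewrite /wpos scanl_cat. Qed.

Lemma wpos_near u ws v : v \in u :: wpos u ws -> near (size ws) u v.
Proof.
elim: ws u v => [|s ws IH] u v; first by rewrite inE => /eqP ->; apply: near_refl.
rewrite inE => /orP[/eqP ->|]; first exact: near_refl.
by move=> /IH; apply: near_trans (near_dstep u s).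
Qed.

Lemma wend_wpos u ws : wend u ws \in u :: wpos u ws.
Proof.
elim: ws u => [|s ws IH] u; first by rewrite inE eqxx.
by rewrite inE; apply/orP; right; apply: IH.
Qed.

Lemma wend_near u ws : near (size ws) u (wend u ws).
Proof. exact/wpos_near/wend_wpos. Qed.

Lemma wedges_near u ws e : e \in wedges u ws -> near (size ws) u e.1.
Proof.
elim: ws u => //= s ws IH u; rewrite inE => /orP[/eqP ->|/IH].
  by apply: near_leq (near_dedge u s).
exact: near_trans (near_dstep u s).
Qed.

Definition dends (e : edge) : seq Z2 := [:: e.1; dual_other_end e.1 e.2].

Lemma dedge_ends u s : perm_eq (dends (dedge u s)) [:: u; dstep u s].
Proof.
have -> : dends (dedge u s) = if s.2 then [:: dstep u s; u] else [:: u; dstep u s].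
  case: u s => a b [d []]; rewrite /dends /dedge /dstep //=; congr [:: _; _].
  by case: d; rewrite /dual_other_end /vadd /=; congr pair; lia.
by case: ifP => // _; apply/permPl; apply: (perm_catC [:: _] [:: _]).
Qed.

Lemma wedges_ends u ws e x :
  e \in wedges u ws -> x \in dends e -> x \in u :: wpos u ws.
Proof.
elim: ws u => //= s ws IH u; rewrite inE => /orP[/eqP ->|/IH].
  rewrite (perm_mem (dedge_ends u s)) !inE => /orP[->//|->].
  by rewrite orbT.
by move=> h /h; rewrite [in X in _ -> X]inE => ->; rewrite orbT.
Qed.

Lemma saw_cons u s ws : saw u (s :: ws) -> saw (dstep u s) ws.
Proof. by case/andP. Qed.

Lemma saw_fresh u s ws e :
  saw u (s :: ws) -> e \in wedges (dstep u s) ws -> u \notin dends e.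
Proof.
case/andP => un _ he; apply: contra un => hu.
exact: wedges_ends he hu.
Qed.

Lemma mem_dends_dedge u s : u \in dends (dedge u s).
Proof. by rewrite (perm_mem (dedge_ends u s)) inE eqxx. Qed.

Lemma saw_uniq_wedges u ws : saw u ws -> uniq (wedges u ws).
Proof.
elim: ws u => //= s ws IH u h; rewrite (IH _ (saw_cons _ _ _ h)) andbT.
by apply/negP => /(saw_fresh _ _ _ _ h); rewrite mem_dends_dedge.
Qed.

Lemma dedge_inj u : injective (dedge u).
Proof.
case: u => a b s t h; have := (congr1 (fun e : edge => e.1.1) h, congr1 (fun e : edge => e.1.2) h, congr1 snd h).
case: s t {h} => [[] []] [[] []]; rewrite /dedge /dstep /vadd /= => -[[h1 h2] h3] //.
all: by exfalso; lia.
Qed.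

(** Only the first edge of a self-avoiding walk touches its starting point, so the edge set
    determines the first step; removing it leaves the same situation one vertex further. *)
Lemma saw_eq_wedges u p q :
  saw u p -> saw u q -> wedges u p =i wedges u q -> p = q.
Proof.
elim: p u q => [|s p IH] u [|t q] sp sq //= eqpq.
- by have := eqpq (dedge u t); rewrite /= in_cons eqxx.
- by have := eqpq (dedge u s); rewrite /= in_cons eqxx.
have st : s = t.
  have := eqpq (dedge u s); rewrite /= !in_cons eqxx => /esym/orP[/eqP/dedge_inj//|].
  by move=> /(saw_fresh _ _ _ _ sq); rewrite mem_dends_dedge.
subst t; congr cons; apply: (IH (dstep u s)); [exact: saw_cons sp|exact: saw_cons sq|].
move=> e; have := eqpq e; rewrite /= !inE.
have [->|//] := eqVneq e (dedge u s) => _.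
have := saw_uniq_wedges _ _ sp; have := saw_uniq_wedges _ _ sq.
by rewrite /= => /andP[/negbTE -> _] /andP[/negbTE -> _].
Qed.

Lemma saw_cat u p q : saw u (p ++ q) -> saw u p /\ saw (wend u p) q.
Proof.
rewrite /saw wpos_cat -cat_cons cat_uniq => /and3P[up dj uq].
split=> //; rewrite /= uq andbT.
by apply/negP => h; move/hasPn: dj => /(_ _ h) /negP; apply; apply: wend_wpos.
Qed.

(* Parity of the number of dual edges of [E] crossed by the horizontal ray
   going right from the primal vertex [x]. *)
Definition ray (E : seq edge) (x : Z2) : bool :=
  odd (count (fun e : edge => e.2 && (e.1.2 == x.2) && (x.1 <= e.1.1)) E).

(** Whether the dual vertex [u] lies in the half-infinite strip between the ray of [x] and the ray
    of the vertex above [x]. *)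
Definition ray_end (u x : Z2) : bool := (u.2 == x.2) && (x.1 <= u.1).

Lemma ray_horizontal E x :
  ray E x (+) ray E (edge_end x true) = odd (count_mem (x, true) E).
Proof.
rewrite /ray; elim: E => // e E IH; rewrite [count _ _]/= [count _ (_ :: _)]/=.
rewrite [count_mem _ (_ :: _)]/= !oddD !oddb -IH.
set A := odd _; set B := odd _; set X := (_ && _); set Y := (_ && _).
suff -> : (e == (x, true)) = X (+) Y by case: X; case: Y; case: A; case: B.
rewrite /X /Y; clear; case: e x => [[a b] []] [p q];
  rewrite /edge_end /vadd /= ?xpair_eqE /=; lia.
Qed.

(** A walk enters or leaves this strip through its bottom, its top or its left side, which is the
    edge [(x, false)]. The parity of these crossings tells whether exactly one end of the walk lies
    in the strip. *)
Lemma ray_vertical u ws x :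
  ray (wedges u ws) x (+) ray (wedges u ws) (edge_end x false)
    (+) odd (count_mem (x, false) (wedges u ws)) = ray_end u x (+) ray_end (wend u ws) x.
Proof.
rewrite /ray; elim: ws u => [|s ws IH] u; first by rewrite /= addbb.
have E1 : forall P e E, odd (count P (e :: E)) = P e (+) odd (count P E).
  by move=> T P e E; rewrite /= oddD oddb.
rewrite [wedges _ _]/= !E1; move: (IH (dstep u s)).
rewrite [wend u _]/= -/(wend _ _) -/(dstep u s).
set A := odd _; set B := odd _; set C := odd _; set D := ray_end (wend _ _) _.
move=> h; have {h} -> : D = A (+) B (+) C (+) ray_end (dstep u s) x.
  by rewrite h addbC addbA addbb.
suff -> : ray_end (dstep u s) x = ray_end u x (+)
  ((dedge u s).2 && ((dedge u s).1.2 == x.2) && (x.1 <= (dedge u s).1.1)) (+)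
  ((dedge u s).2 && ((dedge u s).1.2 == (edge_end x false).2) &&
     ((edge_end x false).1 <= (dedge u s).1.1)) (+) (dedge u s == (x, false)).
  set X := _ && _; set Y := _ && _; rewrite [pred1 _ _]/=; set Z := _ == _.
  by case: (ray_end u x); case: A; case: B; case: C; case: X; case: Y; case: Z.
clear; case: u s x => [a b] [[] []] [p q];
  rewrite /ray_end /edge_end /dedge /dstep /vadd /dual_other_end /vadd /= ?xpair_eqE /= ?andbF ?andbT; lia.
Qed.

(** Each crossing of the line at height [b] changes sides. The dual vertex [u] has height
    [u.2 + 1/2], so it lies below when [u.2 < b]. *)
Lemma odd_row u ws b :
  odd (count (fun e : edge => e.2 && (e.1.2 == b)) (wedges u ws)) =
  (u.2 < b) (+) ((wend u ws).2 < b).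
Proof.
elim: ws u => [|s ws IH] u; first by rewrite /= addbb.
rewrite [wedges _ _]/= [count _ (_ :: _)]/= oddD oddb IH /=.
rewrite addbA; congr addb.
clear; case: u s => [a c] [[] []]; rewrite /dedge /dstep /vadd /dual_other_end /vadd /=; lia.
Qed.

(** The interior modulo 2 of the closed curve formed by two walks with common ends: the set of spins
    to be flipped. *)
Definition region (u : Z2) (p q : seq dir) (x : Z2) : bool :=
  ray (wedges u p) x (+) ray (wedges u q) x.

Lemma count_mem_odd (T : eqType) (s : seq T) x : uniq s -> odd (count_mem x s) = (x \in s).
Proof. by move/count_uniq_mem ->; rewrite oddb. Qed.

(** Horizontally each parity changes exactly at a crossed edge; vertically the end point terms of
    the two walks agree and cancel. *)
Lemma region_edge u p q x d : uniq (wedges u p) -> uniq (wedges u q) ->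
  wend u p = wend u q ->
  region u p q x (+) region u p q (edge_end x d) =
  ((x, d) \in wedges u p) (+) ((x, d) \in wedges u q).
Proof.
move=> up uq epq; rewrite /region -!(count_mem_odd _ _ _ up) -!(count_mem_odd _ _ _ uq).
rewrite addbACA; case: d; first by rewrite !ray_horizontal.
have := ray_vertical u p x; have := ray_vertical u q x; rewrite epq.
set A := ray _ x; set B := ray _ x; set A' := ray _ _; set B' := ray _ _.
case: A; case: B; case: A'; case: B'; case: (odd _); case: (odd _); case: (ray_end _ _);
  case: (ray_end _ _) => //.
Qed.

Lemma eq_odd_count (T : eqType) (P Q : pred T) (s : seq T) :
  {in s, P =1 Q} -> odd (count P s) = odd (count Q s).
Proof. by move/eq_in_count ->. Qed.

(** A ray from outside the ball either misses both walks or starts to their left and sees its whole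
    row. In the latter case the crossing parity depends only on the end points, which the walks
    share. *)
Lemma region_near u p q x n : size p = n -> size q = n -> wend u p = wend u q ->
  region u p q x -> near n u x.
Proof.
move=> sp sq epq; apply: contraTT => nx; rewrite /region.
have H w : size w = n -> ray (wedges u w) x =
    ((x.1 < u.1 - n%:Z) && ((u.2 < x.2) (+) ((wend u w).2 < x.2))).
  move=> sw; have [lt|ge] := boolP (x.1 < u.1 - n%:Z).
    rewrite /ray -odd_row; apply: eq_odd_count => e /wedges_near; rewrite sw => he /=.
    suff -> : x.1 <= e.1.1 by rewrite andbT.
    case: e he => [[a b] d]; rewrite /near /=; lia.
  rewrite /ray (@eq_odd_count _ _ pred0) ?count_pred0 // => e /wedges_near; rewrite sw /= => he.
  by apply/negbTE; case: e he => [[a b] d]; move: nx ge; rewrite /near /=; lia.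
by rewrite !H // epq addbb.
Qed.

Definition eds (C : seq Z2) : seq edge :=
  [seq e <- [seq (x, d) | x <- Cbar C, d <- enum {: bool}] | edge_end e.1 e.2 \in Cbar C].

Lemma mem_eds C e : (e \in eds C) = (e.1 \in Cbar C) && (edge_end e.1 e.2 \in Cbar C).
Proof.
rewrite mem_filter andbC; congr (_ && _); case: e => x d /=.
apply/allpairsP/idP => [[[y b] /= [hy _ [-> _]]] //|hx].
by exists (x, d); rewrite /= mem_enum.
Qed.

Lemma uniq_eds C : uniq (eds C).
Proof.
apply/filter_uniq/allpairs_uniq; [exact: undup_uniq|exact: enum_uniq|].
by move=> [x d] [y b] /= _ _ [-> ->].
Qed.

(** * Energy changes under spin flips and under coupling flips *)

Section Energy.
Context {R : realType}.
Implicit Types (C : seq Z2) (w : Z2 -> bool -> R) (s f : Z2 -> bool) (E : seq edge).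

Definition J w s (e : edge) : R :=
  w e.1 e.2 * spin R (s e.1) * spin R (s (edge_end e.1 e.2)).

Lemma hamiltonianE C w s : hamiltonian R C w s = - \sum_(e <- eds C) J w s e.
Proof.
rewrite /hamiltonian /eds big_filter [in RHS]big_mkcond; congr (- _).
by rewrite big_allpairs; apply: eq_bigr => x _; rewrite big_enum.
Qed.

Lemma spin_xor (a b : bool) : spin R (a (+) b) = (-1) ^+ b * spin R a.
Proof. by case: a; case: b; rewrite /= ?expr0 ?expr1 ?mul1r ?mulN1r ?opprK. Qed.

Lemma normr_spin (a : bool) : `|spin R a| = 1.
Proof. by case: a; rewrite /= ?normrN normr1. Qed.

Lemma normr_J w s e : `|J w s e| = `|w e.1 e.2|.
Proof. by rewrite /J !normrM !normr_spin !mulr1. Qed.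

Definition sxor s f : Z2 -> bool := fun x => s x (+) f x.

Lemma J_sxor w s f e :
  J w (sxor s f) e = (-1) ^+ (f e.1 (+) f (edge_end e.1 e.2)) * J w s e.
Proof. by rewrite /J /sxor !spin_xor signr_addb; ring. Qed.

Definition flipw (P : pred edge) w : Z2 -> bool -> R :=
  fun x d => if P (x, d) then - w x d else w x d.

Lemma flipwK P : involutive (flipw P).
Proof.
move=> w; apply/funext => x; apply/funext => d; rewrite /flipw.
by case: (P _); rewrite ?opprK.
Qed.

Lemma J_flipw P w s e : J (flipw P w) s e = if P e then - J w s e else J w s e.
Proof. by case: e => x d; rewrite /J /flipw /=; case: (P _); rewrite ?mulNr. Qed.

Definition len w E : R := \sum_(e <- E) `|w e.1 e.2|.

Lemma len_flipw P w E : len (flipw P w) E = len w E.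
Proof.
apply: eq_bigr => -[x d] _; rewrite /flipw /=.
by case: ifP => //; rewrite normrN.
Qed.

Definition unsat w s E : bool := all (fun e => J w s e < 0) E.

Lemma len_sum w E E' : uniq E -> uniq E' -> {subset E <= E'} ->
  len w E = \sum_(e <- E') (if e \in E then `|w e.1 e.2| else 0).
Proof.
move=> uE uE' sub; rewrite /len -big_mkcond -[RHS]big_filter; apply: perm_big.
apply: uniq_perm => //; first exact: filter_uniq.
by move=> e; rewrite mem_filter; case: (boolP (e \in E)) => // /sub ->.
Qed.

(* Only the edges crossed by exactly one of the two paths change sign. *)
Lemma hamiltonian_region C w s u p q :
  uniq (wedges u p) -> uniq (wedges u q) -> wend u p = wend u q ->
  {subset wedges u p <= eds C} -> {subset wedges u q <= eds C} ->
  unsat w s (wedges u p) ->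
  hamiltonian R C w (sxor s (region u p q)) <=
  hamiltonian R C w s - 2 * (len w (wedges u p) - len w (wedges u q)).
Proof.
move=> up uq epq sp sq /allP hp.
rewrite !hamiltonianE (len_sum _ _ _ up (uniq_eds C) sp) (len_sum _ _ _ uq (uniq_eds C) sq).
rewrite -!sumrN -!big_split /= mulr_sumr -sumrN -big_split /=.
rewrite !big_seq; apply: ler_sum => -[x d] _.
rewrite J_sxor /= region_edge //.
have := normr_J w s (x, d) => /= hn.
case: (boolP (_ \in wedges u p)) => [/hp|] hp'; case: (boolP (_ \in wedges u q)) => hq /=;
  rewrite ?expr0 ?expr1 -?hn; rewrite ?(ltr0_norm hp'); have := ler_norm (J w s (x, d)); lra.
Qed.

Lemma hamiltonian_flipw C (P : pred edge) w s : hamiltonian R C (flipw P w) s =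
  hamiltonian R C w s + 2 * \sum_(e <- eds C | P e) J w s e.
Proof.
rewrite !hamiltonianE (big_mkcond P) mulr_sumr -!sumrN -big_split /=.
by apply: eq_bigr => e _; rewrite J_flipw; case: ifP => _; ring.
Qed.

(** An unsatisfied edge contributes [- |w e|] to the sum over [P], the least value over all spin
    configurations. Hence reversing these couplings favours [s] over every other [t]. *)
Lemma hamiltonian_flipw_le C (P : pred edge) w s t :
  (forall e, e \in eds C -> P e -> J w s e < 0) ->
  hamiltonian R C (flipw P w) s - hamiltonian R C w s <=
  hamiltonian R C (flipw P w) t - hamiltonian R C w t.
Proof.
move=> h; rewrite !hamiltonian_flipw ![_ + 2 * _]addrC !addrK ler_pM2l //.
rewrite big_seq_cond [leRHS]big_seq_cond; apply: ler_sum => e /andP[he Pe].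
have hs := ltW (h e he Pe); rewrite -[leLHS]opprK -(ler0_norm hs) normr_J -(normr_J w t).
by rewrite lerNl; apply: le_trans (ler_norm _) _; rewrite normrN.
Qed.

Lemma eq_hamiltonian C w s t : {in Cbar C, s =1 t} ->
  hamiltonian R C w s = hamiltonian R C w t.
Proof.
move=> h; rewrite !hamiltonianE; congr (- _); apply: eq_big_seq => e.
by rewrite mem_eds /J => /andP[/h -> /h ->].
Qed.

End Energy.

(** * Gibbs weights and ground states *)

Section Gluing.
Implicit Types (C : seq Z2) (s f : Z2 -> bool) (E : seq edge).

Lemma glue_in C (eta : {ffun seq_sub C -> bool}) s (y : seq_sub C) : Defs.glue C eta s (val y) = eta y.
Proof. by rewrite /Defs.glue valK. Qed.

Lemma glue_out C (eta : {ffun seq_sub C -> bool}) s x : x \notin C -> Defs.glue C eta s x = s x.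
Proof. by move=> xC; rewrite /Defs.glue insubN. Qed.

Lemma glue_sxor C (eta : {ffun seq_sub C -> bool}) s f : (forall x, f x -> x \in C) ->
  sxor (Defs.glue C eta s) f =1 Defs.glue C [ffun y => eta y (+) f (val y)] s.
Proof.
move=> fC x; rewrite /sxor; have [xC|xC] := boolP (x \in C).
  by rewrite -[x]/(val (SeqSub xC)) !glue_in ffunE.
by rewrite !glue_out // (negbTE (contra (fC x) xC)) addbF.
Qed.

Lemma glue_restr C s : Defs.glue C (restr C s) s =1 s.
Proof.
move=> x; have [xC|xC] := boolP (x \in C); last by rewrite glue_out.
by rewrite -[x]/(val (SeqSub xC)) glue_in ffunE.
Qed.

Lemma glue_in_restr C s t x : x \in C -> Defs.glue C (restr C s) t x = s x.
Proof. by move=> xC; rewrite -[x]/(val (SeqSub xC)) glue_in ffunE. Qed.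

Lemma glue_ext C (eta : {ffun seq_sub C -> bool}) s t :
  (forall x, x \in Cbar C -> x \notin C -> s x = t x) ->
  {in Cbar C, Defs.glue C eta s =1 Defs.glue C eta t}.
Proof.
move=> h x xb; have [xC|xC] := boolP (x \in C); last by rewrite !glue_out // h.
by rewrite -[x]/(val (SeqSub xC)) !glue_in.
Qed.

End Gluing.

Section Kernels.
Context {R : realType}.
Implicit Types (C : seq Z2) (s : Z2 -> bool).
Implicit Types (w : Z2 -> bool -> R).

(* The properties shared by the finite-volume Gibbs weights at inverse
   temperature [beta], with [eps = exp (- 2 * beta * a)], and by the indicator
   of the ground state. *)
Record low_temp C (a eps : R)
    (g : (Z2 -> bool -> R) -> (Z2 -> bool) -> {ffun seq_sub C -> bool} -> R) : Prop := LowTemp {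
  ltemp_ge0 : forall w s eta, 0 <= g w s eta ;
  ltemp_sum : forall w s, \sum_eta g w s eta <= 1 ;
  ltemp_flip : forall w s eta (P : pred edge),
    (forall e, e \in eds C -> P e -> J w (Defs.glue C eta s) e < 0) ->
    g w s eta <= g (flipw P w) s eta ;
  ltemp_gain : forall w s eta eta' k,
    hamiltonian R C w (Defs.glue C eta' s) <= hamiltonian R C w (Defs.glue C eta s) - 2 * a * k%:R ->
    g w s eta <= eps ^+ k * g w s eta' }.

Definition ground C w s (eta : {ffun seq_sub C -> bool}) : R :=
  [forall eta', (eta' != eta) ==>
     (hamiltonian R C w (Defs.glue C eta s) < hamiltonian R C w (Defs.glue C eta' s))]%:R.

(** Reversing unsatisfied couplings lowers the energy of the minimizer at least as much as that of
    any other configuration, so it stays strictly minimal. A configuration whose energy is matched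
    or lowered by another one has weight zero; this is why even [eps = 0] is allowed. *)
Lemma ground_low_temp C (a eps : R) : 0 < a -> 0 <= eps -> low_temp C a eps (ground C).
Proof.
move=> a0 e0; split.
- by move=> w s eta; rewrite /ground ler0n.
- move=> w s; have [[eta h]|no] := pselect (exists eta, ground C w s eta = 1).
    rewrite (bigD1 eta) //= h big1 ?addr0 // => eta' ne.
    rewrite /ground; case: forallP => // h'.
    move: h; rewrite /ground; case: forallP => [h _|_ /eqP]; last by rewrite eq_sym oner_eq0.
    have := lt_trans (implyP (h eta') ne) (implyP (h' eta) _).
    by rewrite ltxx eq_sym => /(_ ne).
  rewrite big1 // => eta _; case E : (ground C w s eta == 1).
    by case: no; exists eta; apply/eqP.
  by move: E; rewrite /ground; case: forallP => //; rewrite eqxx.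
- move=> w s eta P hP; rewrite /ground ler_nat; case: forallP => // h.
  case: forallP => // -[] eta'; apply/implyP => /(implyP (h eta')).
  have := hamiltonian_flipw_le C P w _ (Defs.glue C eta' s) hP; lra.
- move=> w s eta eta' k hH; rewrite {1}/ground; case: forallP => h /=; last first.
    by rewrite mulr_ge0 ?exprn_ge0 // /ground ler0n.
  have [ee|ne] := eqVneq eta' eta.
    case: k hH => [_|k]; first by rewrite expr0 mul1r ee /ground; case: forallP.
    rewrite ee => hH; suff : 0 < 2 * a * k.+1%:R by lra.
    by rewrite !mulr_gt0 // ltr0n.
  have := implyP (h eta') ne; have : 0 <= 2 * a * k%:R by rewrite !mulr_ge0 // ltW.
  lra.
Qed.

(** The flip multiplies the weight of [eta] by at least the factor of every term of the partition
    function, so the normalized weight does not decrease. Between [eta] and [eta'] the partition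
    function cancels and only the energy gap remains. *)
Lemma gibbs_low_temp C (a beta : R) : 0 <= beta ->
  low_temp C a (expR (- (2 * beta * a))) (gibbs R beta C).
Proof.
move=> b0.
have Z0 w s : 0 < \sum_(eta : {ffun seq_sub C -> bool}) expR (- beta * hamiltonian R C w (Defs.glue C eta s)).
  rewrite (bigD1 [ffun=> true]) //= ltr_pwDl ?expR_gt0 //.
  by apply: sumr_ge0 => *; apply: expR_ge0.
split.
- by move=> w s eta; rewrite /gibbs divr_ge0 ?expR_ge0 // ltW.
- by move=> w s; rewrite /gibbs -mulr_suml divff // gt_eqF.
- move=> w s eta P hP; rewrite /gibbs ler_pdivrMr // mulrAC ler_pdivlMr //.
  rewrite !mulr_sumr; apply: ler_sum => eta' _; rewrite -!expRD ler_expR.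
  have := ler_wpM2l b0 (hamiltonian_flipw_le C P w _ (Defs.glue C eta' s) hP); rewrite !mulrBr; lra.
- move=> w s eta eta' k hH; rewrite /gibbs mulrA ler_pM2r ?invr_gt0 //.
  rewrite -expRM_natl -expRD ler_expR.
  have := ler_wpM2l b0 hH; rewrite -mulr_natl; lra.
Qed.

End Kernels.

(** * The law of the couplings *)

(** The couplings get a measurable space of their own, since the estimates integrate over them with
    the boundary spins frozen. *)
Definition cyl_J (R : realType) : set (set (Z2 -> bool -> R)) :=
  [set A | exists x d (B : set R), measurable B /\ A = [set w | B (w x d)]].

Definition JSpace (R : realType) := g_sigma_algebraType (@cyl_J R).
HB.instance Definition _ (R : realType) := Measurable.on (JSpace R).

Section Couplings.
Context {R : realType}.
Notation W := (JSpace R).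
Implicit Types (e : edge) (es : seq edge) (B : edge -> set R).

Lemma measurable_coupling x d : measurable_fun [set: W] (fun w : W => w x d).
Proof.
move=> _ B mB; rewrite setTI; apply: sub_sigma_algebra.
by exists x, d, B.
Qed.

Lemma measurable_to_couplings d (T : measurableType d) (f : T -> W) :
  (forall x b, measurable_fun [set: T] (fun t => f t x b)) -> measurable_fun [set: T] f.
Proof.
move=> h; have := @measurability _ _ T W setT f (@cyl_J R). apply => // _ [_ [x [b [B [mB ->]]]] <-].
exact: h.
Qed.

Definition wfst (c : ConfigSpace R) : W := c.1.

Lemma measurable_wfst : measurable_fun [set: ConfigSpace R] wfst.
Proof.
apply: measurable_to_couplings => x b _ B mB; rewrite setTI.
apply: sub_sigma_algebra; left; by exists x, b, B.
Qed.
HB.instance Definition _ := isMeasurableFun.Build _ _ _ _ wfst measurable_wfst.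

Lemma measurable_flipw (P : pred edge) : measurable_fun [set: W] (flipw P : W -> W).
Proof.
apply: measurable_to_couplings => x b; rewrite /flipw; case: (P _).
  by apply: measurableT_comp => //; exact: measurable_coupling.
exact: measurable_coupling.
Qed.
HB.instance Definition _ (P : pred edge) :=
  isMeasurableFun.Build _ _ W W (flipw P : W -> W) (measurable_flipw P).

(** The value 0 stands for a forgotten coupling: a function of the other couplings is a function of
    [erase e w], and no splitting of the product space is needed. *)
Definition erase e (w : W) : W := fun x d => if (x, d) == e then 0 else w x d.

Lemma measurable_erase e : measurable_fun [set: W] (erase e).
Proof.
apply: measurable_to_couplings => x b; rewrite /erase; case: (_ == _).
  exact: measurable_cst.
exact: measurable_coupling.
Qed.
HB.instance Definition _ e := isMeasurableFun.Build _ _ W W (erase e) (measurable_erase e).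

Definition rect es B : set W := [set w | forall e, e \in es -> B e (w e.1 e.2)].

Lemma measurable_rect es B : (forall e, measurable (B e)) -> measurable (rect es B).
Proof.
move=> mB; elim: es => [|e es IH].
  by rewrite (_ : rect _ _ = setT) //; apply/seteqP; split.
rewrite (_ : rect _ _ = [set w : W | B e (w e.1 e.2)] `&` rect es B).
  apply: measurableI => //; rewrite -[X in measurable X]setTI.
  exact: measurable_coupling.
apply/seteqP; split => [w h|w [h1 h2] f].
  by split=> [|f fe]; apply: h; rewrite inE ?eqxx ?fe ?orbT.
by rewrite inE => /orP[/eqP ->|]; [exact: h1|exact: h2].
Qed.

(** Rectangles generate the sigma-algebra and are stable under intersection, a missing constraint
    being [setT]. *)
Lemma couplings_measure_unique (m1 m2 : {measure set W -> \bar R}) :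
  (m1 setT < +oo)%E ->
  (forall es B, uniq es -> (forall e, measurable (B e)) -> m1 (rect es B) = m2 (rect es B)) ->
  forall A, measurable A -> m1 A = m2 A.
Proof.
move=> fin h; pose G : set (set W) :=
  [set A | exists es B, [/\ uniq es, (forall e, measurable (B e)) & A = rect es B]].
have GT : G setT.
  by exists [::], (fun=> setT); split => //; apply/seteqP; split.
apply: (measure_unique G (fun=> setT)) => //.
- apply/seteqP; split.
    apply: smallest_sub; first exact: smallest_sigma_algebra.
    move=> _ [x [d [B [mB ->]]]]; apply: sub_sigma_algebra.
    exists [:: (x, d)], (fun=> B); split => //.
    apply/seteqP; split => [w Bw e|w]; first by rewrite inE => /eqP ->.
    by move=> hw; apply: (hw (x, d)); rewrite inE.
  apply: smallest_sub; first exact: sigma_algebra_measurable.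
  by move=> _ [es [B [_ mB ->]]]; apply: measurable_rect.
- move=> _ _ [es1 [B1 [u1 m1' ->]]] [es2 [B2 [u2 m2' ->]]].
  exists (undup (es1 ++ es2)), (fun e => (if e \in es1 then B1 e else setT) `&`
    (if e \in es2 then B2 e else setT)); split.
  + exact: undup_uniq.
  + by move=> e; apply: measurableI; case: ifP.
  + apply/seteqP; split => [w [h1 h2] e|w hw].
      by move=> _; split; [case: ifP => // he; exact: h1|case: ifP => // he; exact: h2].
    by split=> e he; have := hw e; rewrite mem_undup mem_cat he ?orbT => -[].
- by rewrite bigcup_const.
- by move=> _ [es [B [u mB ->]]]; exact: h.
Qed.

End Couplings.

(** * Symmetry and bounded density of the standard normal law *)

Section NormalLaw.
Context {R : realType}.

Lemma normal_probN (B : set R) : measurable B ->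
  normal_prob 0 1 (-%R @^-1` B) = normal_prob 0 1 B :> \bar R.
Proof.
move=> mB; rewrite /normal_prob.
transitivity (\int[pushforward lebesgue_measure (-%R : _ -> measurableTypeR R)]_(x in B)
  (normal_pdf 0 1 x)%:E)%E; last first.
  by apply: eq_measure_integral => A mA _; exact: lebesgue_measureN.
rewrite ge0_integral_pushforward //.
- apply: eq_integral => x _ /=; rewrite /normal_pdf /normal_fun oner_eq0.
  by rewrite !subr0 sqrrN.
- by apply/measurable_EFinP/measurable_funTS; exact: measurable_normal_pdf.
- by move=> x _; rewrite lee_fin normal_pdf_ge0.
Qed.

Lemma normal_prob_itv (b l : R) : 0 < l ->
  (normal_prob 0 1 `]b, (b + l)%R[%classic <= (normal_peak 1 * l)%:E :> \bar R)%E.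
Proof.
move=> l0; apply: (@le_trans _ _
    (\int[lebesgue_measure]_(x in `]b, (b + l)%R[%classic) (cst (normal_peak 1 : R)%:E) x)%E).
  apply: ge0_le_integral => //=.
  - by move=> x _; rewrite lee_fin normal_pdf_ge0.
  - by apply/measurable_EFinP/measurable_funTS; exact: measurable_normal_pdf.
  - by move=> x _; rewrite lee_fin normal_pdf_ub.
rewrite integral_cst //= lebesgue_measure_itv /= lte_fin ltrDl l0 -EFinD EFinM.
by rewrite addrAC subrr add0r.
Qed.

(** The condition puts [t] in one of two intervals of length [2 * a], around [y] and around [- y],
    and the density is at most [normal_peak 1]. *)
Lemma normal_prob_norm_ball (y a : R) : 0 < a ->
  (normal_prob 0 1 [set t : R | (`| `|t| - y| < a)%R] <= (normal_peak 1 * (4 * a))%:E)%E.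
Proof.
move=> a0; pose I b : set R := `]b, (b + 2 * a)[%classic.
have mS : measurable [set t : R | (`| `|t| - y| < a)%R].
  rewrite (_ : [set _ | _] = (fun t : R => `| `|t| - y| < a) @^-1` [set true]) //.
  rewrite -[X in measurable X]setTI; apply: measurable_fun_ltr => //.
  by apply: measurableT_comp => //; apply: measurable_funB => //; exact: measurableT_comp.
apply: (@le_trans _ _ (normal_prob 0 1 (I (y - a) `|` I (- y - a)))).
  apply: le_measure; rewrite ?inE //; first by apply: measurableU; exact: measurable_itv.
  move=> t /=; rewrite ltr_norml => /andP[h1 h2].
  have [t0|t0] := leP 0 t.
    by left; rewrite /I /= in_itv /=; move: h1 h2; rewrite ger0_norm //; lra.
  by right; rewrite /I /= in_itv /=; move: h1 h2; rewrite ltr0_norm //; lra.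
apply: le_trans; first by apply: measureU2; exact: measurable_itv.
have a2 : 0 < 2 * a by rewrite mulr_gt0.
apply: le_trans; first by apply: leeD; apply: normal_prob_itv.
by rewrite -EFinD lee_fin; lra.
Qed.

End NormalLaw.

Section IidCouplings.
Context {R : realType}.
Notation W := (JSpace R).

Definition iid_couplings (rho : set W -> \bar R) : Prop :=
  forall (es : seq edge) (B : edge -> set R),
    uniq es -> (forall e, measurable (B e)) ->
    rho (rect es B) = (\prod_(e <- es) normal_prob 0 1 (B e))%E.

Variable rho : probability W R.
Hypothesis iid : iid_couplings rho.

Lemma couplings_flip (P : pred edge) (A : set W) : measurable A ->
  distribution rho (flipw P : W -> W) A = rho A.
Proof.
move=> mA; apply: couplings_measure_unique mA; first by apply: (le_lt_trans _ (ltry 1)); exact: probability_le1.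
move=> es B ues mB; pose B' e := if P e then -%R @^-1` B e else B e.
have pre : (flipw P : W -> W) @^-1` rect es B = rect es B'.
  rewrite /rect; apply/seteqP; split => w hw e he; have := hw e he;
    by case: e {he} => x d; rewrite /flipw /B' /=; case: ifP.
suff E : rho ((flipw P : W -> W) @^-1` rect es B) = (\prod_(e <- es) normal_prob 0 1 (B e))%E.
  exact: etrans E (esym (iid es B ues mB)).
rewrite pre iid // => [|e].
  by apply: eq_bigr => e _; rewrite /B'; case: ifP => // _; rewrite normal_probN.
by rewrite /B'; case: ifP => // _; rewrite -[X in measurable X]setTI; exact: oppr_measurable.
Qed.

Lemma integral_flipw (P : pred edge) (D : set W) (F : W -> \bar R) :
  measurable D -> (forall w, D (flipw P w) <-> D w) ->
  measurable_fun setT F -> (forall w, (0 <= F w)%E) ->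
  (\int[rho]_(w in D) F (flipw P w) = \int[rho]_(w in D) F w)%E.
Proof.
move=> mD hD mF F0.
transitivity (\int[distribution rho (flipw P : W -> W)]_(w in D) F w)%E; last first.
  by apply: eq_measure_integral => A mA _; exact: couplings_flip.
rewrite /distribution ge0_integral_pushforward //; last exact: measurable_funTS mF.
by congr integral; apply/seteqP; split => w /= /hD.
Qed.

Definition erase_pair (e : edge) (w : W) : W * measurableTypeR R := (erase e w, w e.1 e.2).

Lemma measurable_erase_pair e : measurable_fun setT (erase_pair e).
Proof.
apply: measurable_fun_pair; first exact: measurable_erase.
exact: measurable_coupling.
Qed.
HB.instance Definition _ e :=
  isMeasurableFun.Build _ _ _ _ (erase_pair e) (measurable_erase_pair e).


End IidCouplings.

Section IidCouplings.
Context {R : realType}.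
Notation W := (JSpace R).
Variable rho : probability W R.
Hypothesis iid : iid_couplings rho.
(** Both sides are finite measures in [A], so it suffices to compare them on rectangles. *)
Lemma indep_erase (e : edge) (A : set W) (B : set R) : measurable A -> measurable B ->
  rho (erase e @^-1` A `&` [set w | B (w e.1 e.2)]) =
  (rho (erase e @^-1` A) * normal_prob 0 1 B)%E.
Proof.
move=> mA mB; pose V : set W := [set w | B (w e.1 e.2)].
have mV : measurable V by rewrite -[X in measurable X]setTI; exact: measurable_coupling.
pose r : {nonneg R} := NngNum (fine_ge0 (measure_ge0 (normal_prob 0 1 : probability _ R) B)).
have rE : (r%:num%:E = normal_prob 0 1 B)%E.
  by rewrite /= fineK //; exact: (fin_num_measure (normal_prob 0 1 : probability _ R)).
suff : pushforward (mrestr rho mV) (erase e) A = mscale r (distribution rho (erase e)) A.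
  by rewrite /pushforward /mrestr /mscale -rE /= muleC => ->.
pose m1 : {measure set W -> \bar R} := measure_function_pushforward__canonical__measure_function_Measure (mrestr rho mV) (measurable_erase e).
move: mA; apply: (@couplings_measure_unique R m1 (mscale r (distribution rho (erase e)))).
  rewrite /m1 /= /pushforward /mrestr preimage_setT setTI.
  exact: le_lt_trans (probability_le1 rho mV) (ltry 1).
move=> es C ues mC; rewrite /m1 /= /pushforward /mrestr /mscale /distribution /pushforward.
rewrite rE muleC /= /distribution /pushforward /=.
pose C' f := if f == e then B else C f.
have mC' f : measurable (C' f) by rewrite /C'; case: ifP.
have ue : uniq (rem e es) by exact: rem_uniq.
(* A rectangle sees the value 0 at the erased coordinate: its preimage is empty, or leaves [e]
   unconstrained. *)
have [h0|h0] := pselect (e \in es -> C e 0); last first.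
  have -> : erase e @^-1` rect es C = set0.
    rewrite -subset0 => w hw; apply: h0 => he.
    by have := hw e he; rewrite /erase -surjective_pairing eqxx.
  by rewrite set0I !measure0 mul0e.
have pre : erase e @^-1` rect es C = rect (rem e es) C.
  apply/seteqP; split => w hw f.
    move=> he; have := hw f (mem_rem he); rewrite /erase -surjective_pairing.
    by move: he; rewrite mem_rem_uniq // inE => /andP[/negbTE -> _].
  move=> he; rewrite /erase -surjective_pairing; have [fe|ne] := eqVneq f e; first subst f.
    exact: h0.
  by apply: hw; rewrite mem_rem_uniq // inE ne.
have preV : rect (rem e es) C `&` V = rect (e :: rem e es) C'.
  apply/seteqP; split => [w [hw Vw] f|w hw].
    rewrite inE /C' => /orP[/eqP ->|he]; first by rewrite eqxx.
    by have := he; rewrite mem_rem_uniq // inE => /andP[/negbTE -> _]; exact: hw.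
  split; last by have := hw e; rewrite /C' eqxx inE eqxx; exact.
  move=> f he; have := hw f; rewrite inE he orbT /C'.
  by have := he; rewrite mem_rem_uniq // inE => /andP[/negbTE -> _]; exact.
rewrite pre preV iid //; last by rewrite /= ue mem_rem_uniq // inE eqxx.
rewrite iid // big_cons /C' eqxx muleC; congr (_ * _)%E.
apply: eq_big_seq => f; rewrite mem_rem_uniq // inE => /andP[/negbTE -> _] //.
Qed.

(* Conditionally on the other couplings, the law of [w e] has a bounded
   density, so that [`|w e|] is rarely close to the value of [Y]. *)
Lemma anticoncentration e (A : set W) (Y : W -> R) (a : R) : 0 < a ->
  measurable A -> measurable_fun setT Y ->
  (rho (erase e @^-1` A `&` [set w | (`| `|w e.1 e.2| - Y (erase e w)| < a)%R]) <=
   (normal_peak 1 * (4 * a))%:E * rho (erase e @^-1` A))%E.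
Proof.
move=> a0 mA mY; pose m1 := distribution rho (erase e : W -> W).
pose N := (normal_prob 0 1 : probability (measurableTypeR R) R).
pose Q : set (W * measurableTypeR R) :=
  [set p | A p.1 /\ (`| `|p.2| - Y p.1| < a)%R].
have mQ : measurable Q.
  have -> : Q = (A `*` setT) `&` ((fun p : W * measurableTypeR R => `| `|p.2| - Y p.1| < a) @^-1` [set true]).
    apply/seteqP; split => -[w t] /=; first by case.
    by case=> -[].
  apply: measurableI; first exact: measurableX.
  rewrite -[X in measurable X]setTI; apply: measurable_fun_ltr => //.
  apply: measurableT_comp => //; apply: measurable_funB; first by apply: measurableT_comp.
  by apply: measurableT_comp.
have := @product_measure_unique _ _ _ _ R m1 N
  (distribution rho (erase_pair e : W -> (W * measurableTypeR R)%type)).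
have -> : erase e @^-1` A `&` [set w | (`| `|w e.1 e.2| - Y (erase e w)| < a)%R] =
   erase_pair e @^-1` Q by [].
move=> /(_ _ Q mQ) H.
have -> : rho (erase_pair e @^-1` Q) = (m1 \x N)%E Q.
  apply/esym/H => A1 A2 mA1 mA2; exact: indep_erase.
rewrite /product_measure1 /=. 
have -> : ((normal_peak 1 * (4 * a))%:E * rho (erase e @^-1` A))%E =
    (\int[m1]_w (((normal_peak 1 * (4 * a))%:E * (\1_A w)%:E)%E))%E.
  rewrite ge0_integralZl //=.
  - by rewrite integral_indic // setIT.
  - by apply/measurable_EFinP; exact: measurable_indic.
  - by rewrite lee_fin !mulr_ge0 ?normal_peak_ge0 // ltW.
apply: ge0_le_integral => //=.
  - exact: measurable_fun_xsection.
  - by apply: emeasurable_funM => //; apply/measurable_EFinP; exact: measurable_indic.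
  - move=> w _; rewrite indicE; have [Aw|nA] := boolP (w \in A).
      rewrite mule1; apply: le_trans (normal_prob_norm_ball (Y w) a a0).
      rewrite (_ : xsection Q w = [set t | (`| `|t| - Y w| < a)%R]) //.
      apply/seteqP; split => t; rewrite /xsection /= inE; first by case.
      by move=> ht; split => //; move: Aw; rewrite inE.
    rewrite (_ : xsection Q w = set0) ?measure0 ?mule0 //.
    rewrite -subset0 => t; rewrite /xsection /= inE => -[/= Aw _].
    by move: nA; rewrite notin_setE.
Qed.

End IidCouplings.

(** * Finite unions and intersections of events *)

Section FiniteUnions.
Context d (T : measurableType d) (R : realType).

Lemma measurable_exists (I : finType) (F : I -> set T) :
  (forall i, measurable (F i)) -> measurable [set t | exists i, F i t].
Proof.
move=> mF; rewrite (_ : [set _ | _] = \bigcup_i F i).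
  by apply: fin_bigcup_measurable => // i _; exact: mF.
by apply/seteqP; split => t [i]; [exists i|move=> _ h; exists i].
Qed.

Lemma measurable_forall (I : finType) (F : I -> set T) :
  (forall i, measurable (F i)) -> measurable [set t | forall i, F i t].
Proof.
move=> mF; rewrite (_ : [set _ | _] = \bigcap_i F i).
  by apply: fin_bigcap_measurable => // i _; exact: mF.
by apply/seteqP; split => t h i //; exact: h.
Qed.

Lemma measurable_boolset (b : T -> bool) : measurable_fun setT b -> measurable [set t | b t].
Proof.
move=> mb; rewrite -[X in measurable X]setTI.
exact: (mb measurableT [set true]).
Qed.

Lemma measure_fin_union (mu : {measure set T -> \bar R}) (I : finType) (F : I -> set T) (A : set T) :
  measurable A -> (forall i, measurable (F i)) -> (forall t, A t -> exists i, F i t) ->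
  (mu A <= \sum_i mu (F i))%E.
Proof.
move=> mA mF sub; apply: (@le_trans _ _ (mu (\big[setU/set0]_i F i))).
  apply: le_measure; rewrite ?inE //; first exact: bigsetU_measurable.
  by move=> t /sub [i Fi]; rewrite -bigcup_seq; exists i => //=; rewrite mem_index_enum.
elim: (index_enum I) => [|i r IH]; first by rewrite !big_nil measure0.
rewrite !big_cons; apply: le_trans; first by apply: measureU2 => //; exact: bigsetU_measurable.
exact: leeD.
Qed.

Lemma sume_const_card (I : finType) (c : \bar R) : (\sum_(i : I) c = #|I|%:R%:E * c)%E.
Proof. by rewrite mule_natl sumr_const. Qed.

Lemma measure_fin_union_le (mu : {measure set T -> \bar R}) (I : finType) (F : I -> set T)
    (A : set T) (c : \bar R) :
  measurable A -> (forall i, measurable (F i)) -> (forall t, A t -> exists i, F i t) ->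
  (forall i, mu (F i) <= c)%E -> (mu A <= #|I|%:R%:E * c)%E.
Proof.
move=> mA mF sub le; apply: le_trans; first exact: (measure_fin_union mu I F).
by rewrite -sume_const_card; exact: lee_sum.
Qed.

End FiniteUnions.

(** * Near ties *)

Section NearTies.
Context {R : realType}.
Notation W := (JSpace R).
Implicit Types (L : nat) (u v : Z2) (w : W).

Lemma measurable_len (E : seq edge) : measurable_fun [set: W] (fun w : W => len w E).
Proof.
apply: measurable_sum => e; apply: measurableT_comp => //; exact: measurable_coupling.
Qed.

(** The two walks need not end at the same point. Only couplings within distance [L] of [u] are
    involved. *)
Definition near_tie L (a : R) u : set W := [set w | exists pq : L.-tuple dir * L.-tuple dir,
  [&& pq.1 != pq.2, saw u pq.1, saw u pq.2 &
      `|len w (wedges u pq.1) - len w (wedges u pq.2)| < a]].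

Lemma measurable_near_tie L a u : measurable (near_tie L a u).
Proof.
apply: measurable_exists => -[p q] /=; apply: measurable_boolset.
do 3 (apply: measurable_and; first exact: measurable_cst).
apply: measurable_fun_ltr => //; apply: measurableT_comp => //.
by apply: measurable_funB; exact: measurable_len.
Qed.

Definition avoids (A : set W) (e : edge) := forall w, A (erase e w) <-> A w.

Lemma len_erase e w (E : seq edge) : e \notin E -> len (erase e w) E = len w E.
Proof.
move=> eE; apply: eq_big_seq => f fE; rewrite /erase -surjective_pairing.
by case: eqVneq => // fe; rewrite fe (negbTE eE) in fE.
Qed.

Lemma near_tie_avoids L a u e : ~~ near L u e.1 -> avoids (near_tie L a u) e.
Proof.
move=> ne w; have H (p : L.-tuple dir) : len (erase e w) (wedges u p) = len w (wedges u p).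
  by apply: len_erase; apply: contra ne => /wedges_near; rewrite size_tuple.
by split=> -[pq h]; exists pq; rewrite !H in h *.
Qed.

Variable rho : probability W R.
Hypothesis iid : iid_couplings rho.

Definition tie_bound L (a : R) : R :=
  (normal_peak 1 * (4 * a)) *+ #|{: L.-tuple dir * L.-tuple dir}|.

(** Union bound over pairs of words. For one pair, choose an edge [e] used by the first walk only:
    given the other couplings, [|w e|] must lie within [a] of a fixed value, while [A] does not
    depend on [w e] and survives as a factor. *)
Lemma near_tie_prob L (a : R) u (A : set W) : 0 < a -> measurable A ->
  (forall e, near L u e.1 -> avoids A e) ->
  (rho (A `&` near_tie L a u) <= (tie_bound L a)%:E * rho A)%E.
Proof.
move=> a0 mA hA.
have c0 : 0 <= normal_peak 1 * (4 * a) by rewrite !mulr_ge0 ?normal_peak_ge0 // ltW.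
pose F (pq : L.-tuple dir * L.-tuple dir) : set W := [set w | A w /\
  [&& pq.1 != pq.2, saw u pq.1, saw u pq.2 &
      `|len w (wedges u pq.1) - len w (wedges u pq.2)| < a]].
have mF pq : measurable (F pq).
  apply: measurableI => //; apply: measurable_boolset.
  do 3 (apply: measurable_and; first exact: measurable_cst).
  apply: measurable_fun_ltr => //; apply: measurableT_comp => //.
  by apply: measurable_funB; exact: measurable_len.
rewrite /tie_bound -mulr_natl EFinM -muleA.
apply: (measure_fin_union_le _ _ _ rho _ F) => //.
- by apply: measurableI => //; exact: measurable_near_tie.
- by move=> w [Aw [pq h]]; exists pq; split.
move=> -[p q].
have [/and3P[pq sp sq]|no] := boolP [&& p != q, saw u p & saw u q]; last first.
  rewrite (_ : F _ = set0) ?measure0; last first.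
    by rewrite -subset0 => w [_ /= /and4P[h1 h2 h3 _]]; case/negP: no; rewrite h1 h2 h3.
  by rewrite mule_ge0.
(* If all edges of [p] were edges of [q], the equal numbers of edges would make the edge sets, and
   then the walks, equal. *)
have [e ep eq] : exists2 e, e \in wedges u p & e \notin wedges u q.
  apply/allPn; apply: contra pq => /allP sub; apply/eqP/val_inj => /=.
  apply: (saw_eq_wedges u) => //; apply: (uniq_min_size (saw_uniq_wedges _ _ sp) sub _).2.
  by rewrite !size_wedges !size_tuple.
pose Y w := len w (wedges u q) - len w (rem e (wedges u p)).
have mY : measurable_fun setT Y by apply: measurable_funB; exact: measurable_len.
have ne : near L u e.1 by have := wedges_near _ _ _ ep; rewrite size_tuple.
have := anticoncentration rho iid e A Y a a0 mA mY.
have -> : erase e @^-1` A = A by apply/seteqP; split => w /(hA e ne w).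
apply: le_trans; apply: le_measure; rewrite ?inE //.
  apply: measurableI => //; apply: measurable_boolset; apply: measurable_fun_ltr => //.
  apply: measurableT_comp => //; apply: measurable_funB.
    by apply: measurableT_comp => //; exact: measurable_coupling.
  by apply: measurableT_comp => //; exact: measurable_erase.
move=> w [Aw /and4P[_ _ _ h]]; split => //=; move: h; rewrite /Y len_erase // len_erase; last first.
  by rewrite mem_rem_uniq ?inE ?eqxx //; exact: saw_uniq_wedges.
rewrite {1}/len (perm_big _ (perm_to_rem ep)) big_cons -/(len w _) => h.
by rewrite opprB addrA.
Qed.

(** Induction on [S]: ties at the other points depend only on couplings out of reach of [u], so they
    can serve as the event [A] above. *)
Lemma near_tie_prob_far L (a : R) (S : seq Z2) : 0 < a ->
  pairwise (fun u v => ~~ near (L + L) u v) S ->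
  (rho [set w | forall u, u \in S -> near_tie L a u w] <= (tie_bound L a ^+ size S)%:E)%E.
Proof.
move=> a0; elim: S => [|u S IH] /=.
  by move=> _; rewrite expr0; apply: probability_le1; rewrite (_ : [set _ | _] = setT) //; apply/seteqP; split.
move=> /andP[/allP uS /IH{}IH].
have -> : [set w | forall v, v \in u :: S -> near_tie L a v w] =
   [set w | forall v, v \in S -> near_tie L a v w] `&` near_tie L a u.
  apply/seteqP; split => [w h|w [h hu] v].
    by split=> [v vS|]; apply: h; rewrite inE ?vS ?orbT ?eqxx.
  by rewrite inE => /orP[/eqP ->|/h].
have mS (s : seq Z2) : measurable [set w | forall v, v \in s -> near_tie L a v w].
  elim: s => [|v s IHs]; first by rewrite (_ : [set _ | _] = setT) //; apply/seteqP; split.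
  rewrite (_ : [set _ | _] = near_tie L a v `&` [set w | forall v, v \in s -> near_tie L a v w]).
    by apply: measurableI => //; exact: measurable_near_tie.
  apply/seteqP; split => [w h|w [h hu] t].
    by split=> [|t ts]; apply: h; rewrite inE ?ts ?orbT ?eqxx.
  by rewrite inE => /orP[/eqP ->|/hu].
apply: le_trans; first apply: near_tie_prob => //.
  move=> e ue w; have H v : v \in S -> avoids (near_tie L a v) e.
    move=> vS; apply: near_tie_avoids; apply: contra (uS v vS) => ve.
    by rewrite near_sym in ve; exact: near_trans ue ve.
  by split=> h v vS; apply/(H v vS); exact: h.
rewrite exprS EFinM; apply: lee_wpmul2l => //; rewrite lee_fin /tie_bound mulrn_wge0 //.
by rewrite !mulr_ge0 ?normal_peak_ge0 // ltW.
Qed.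

End NearTies.

(** * Unsatisfied paths given the boundary condition *)

Section Driven.
Context {R : realType}.
Notation W := (JSpace R).
Variable nu : probability (ConfigSpace R) R.
Let rho := distribution nu (@wfst R).

Lemma iid_couplings_marginal : iid_std_normal R nu -> iid_couplings rho.
Proof. by move=> h es B ues mB; rewrite -h. Qed.

(** The default [false] is arbitrary: once [bd] contains the outer boundary of [C], the Hamiltonian
    of [C] reads no spin beyond [C] and [bd]. *)
Definition bc (bd : seq Z2) (tau : {ffun seq_sub bd -> bool}) : Z2 -> bool :=
  Defs.glue bd tau (fun=> false).

(* [g] bounds from above the conditional law of the spins in [C], uniformly in
   the spins on the outer boundary [bd], which may depend on all couplings. *)
Record driven (C bd : seq Z2) (g : W -> (Z2 -> bool) -> {ffun seq_sub C -> bool} -> R) : Prop :=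
  Driven {
  drv_measurable : forall s eta, measurable_fun setT (fun w : W => g w s eta) ;
  drv_le : forall (tau : {ffun seq_sub bd -> bool}) eta (F : set W), measurable F ->
    (nu (@wfst R @^-1` F `&` [set c | restr bd c.2 = tau /\ restr C c.2 = eta]) <=
     \int[rho]_(w in F) (g w (bc bd tau) eta)%:E)%E }.

Lemma measurable_hamiltonian C s : measurable_fun setT (fun w : W => hamiltonian R C w s).
Proof.
apply: (eq_measurable_fun (fun w : W => - \sum_(e <- eds C) J w s e)).
  by move=> w _; rewrite hamiltonianE.
apply: measurableT_comp => //; apply: measurable_sum => e; rewrite /J.
do 2 apply: measurable_funM => //; exact: measurable_coupling.
Qed.

Lemma measurable_gibbs beta C s eta : measurable_fun setT (fun w : W => gibbs R beta C w s eta).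
Proof.
have mE eta' : measurable_fun setT
    (fun w : W => expR (- beta * hamiltonian R C w (Defs.glue C eta' s))).
  apply: measurableT_comp => //; apply: measurable_funM => //.
  exact: measurable_hamiltonian.
(* Division by the positive partition function is written as a product with the exponential of minus
   its logarithm, a composition of measurable functions. *)
apply: (eq_measurable_fun (fun w : W => expR (- beta * hamiltonian R C w (Defs.glue C eta s)) *
  expR (- ln (\sum_(eta' : {ffun seq_sub C -> bool})
     expR (- beta * hamiltonian R C w (Defs.glue C eta' s)))))).
  move=> w _; rewrite /gibbs expRN lnK // posrE (bigD1 eta) //= ltr_pwDl ?expR_gt0 //.
  by apply: sumr_ge0 => *; exact: expR_ge0.
apply: measurable_funM => //; apply: measurableT_comp => //; apply: measurableT_comp => //.
by apply: measurableT_comp; [exact: measurable_ln|exact: measurable_sum].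
Qed.

Lemma measurable_ground C s eta : measurable_fun setT (fun w : W => ground C w s eta).
Proof.
pose b := fun w : W => [forall eta', (eta' != eta) ==>
     (hamiltonian R C w (Defs.glue C eta s) < hamiltonian R C w (Defs.glue C eta' s))].
have mb : measurable_fun setT b.
  apply: (measurable_fun_bool true) => //; rewrite setTI.
  rewrite (_ : _ @^-1` _ = [set w | forall eta', (eta' != eta) ==>
     (hamiltonian R C w (Defs.glue C eta s) < hamiltonian R C w (Defs.glue C eta' s))]).
    apply: measurable_forall => eta'; apply: measurable_boolset.
    case: (_ != _); last exact: measurable_cst.
    by apply: measurable_fun_ltr; exact: measurable_hamiltonian.
  by apply/seteqP; split => w /forallP.
apply: (eq_measurable_fun (fun w : W => if b w then 1 else 0 : R)).
  by move=> w _; rewrite /ground /b; case: ifP.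
by apply: measurable_fun_ifT => //; exact: measurable_cst.
Qed.


Lemma measurable_agree (G : set (set (Config R))) (bd : seq Z2) (tau : {ffun seq_sub bd -> bool}) :
  (forall x b, x \in bd -> <<s G >> [set c : Config R | c.2 x = b]) ->
  <<s G >> [set c : Config R | restr bd c.2 = tau].
Proof.
move=> h; rewrite (_ : [set _ | _] = [set c : Config R | forall y : seq_sub bd, c.2 (val y) = tau y]).
  apply: (@measurable_forall _ (g_sigma_algebraType G)) => y.
  by apply: h; exact: valP.
apply/seteqP; split => c /=.
  by move=> <- y; rewrite ffunE.
by move=> e; apply/ffunP => y; rewrite ffunE; exact: e.
Qed.

Lemma measurable_spin_sets (bd : seq Z2) (tau : {ffun seq_sub bd -> bool}) :
  measurable [set c : ConfigSpace R | restr bd c.2 = tau].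
Proof.
apply: (measurable_agree (@cylinders R)) => x b _; apply: sub_sigma_algebra.
by right; exists x, b.
Qed.

Lemma measurable_wfst_preimage (F : set W) : measurable F -> measurable (@wfst R @^-1` F).
Proof. by move=> mF; rewrite -[X in measurable X]setTI; exact: measurable_wfst. Qed.

(** Off a null set the spins in [C] are the unique minimizer for their own boundary spins, so the
    event forces the couplings into the set where [ground] equals 1. *)
Lemma ground_driven C bd : (forall x, x \in Cbar C -> x \notin C -> x \in bd) ->
  ground_state R nu -> driven C bd (ground C).
Proof.
move=> hbd [_ gs]; split; first exact: measurable_ground.
move=> tau eta F mF.
have mg := measurable_ground C (bc bd tau) eta.
have mG : measurable [set w : W | ground C w (bc bd tau) eta = 1].
  by rewrite -[X in measurable X]setTI; exact: (mg measurableT [set 1] (measurable_set1 1)).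
apply: (@le_trans _ _ (rho (F `&` [set w : W | ground C w (bc bd tau) eta = 1]))); last first.
  have -> : rho (F `&` [set w : W | ground C w (bc bd tau) eta = 1]) =
      (\int[rho]_(w in F) (\1_[set w : W | ground C w (bc bd tau) eta = 1] w)%:E)%E.
    by rewrite integral_indic // setIC.
  apply: ge0_le_integral => //=.
  - by apply/measurable_EFinP; exact: measurable_indic.
  - by apply/measurable_EFinP; apply: measurable_funTS.
  - move=> w _; rewrite lee_fin indicE; case: (boolP (w \in _)) => [|_]; first by rewrite inE => ->.
    exact: (ltemp_ge0 _ _ _ _ (ground_low_temp C 1 1 ltr01 ler01)).
case: gs => N [mN N0 sub].
set Y := F `&` _.
have mY : measurable Y by exact: measurableI.
apply: (@le_trans _ _ (nu (@wfst R @^-1` Y `|` N))).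
  apply: le_measure; rewrite ?inE.
  - apply: measurableI; first exact: measurable_wfst_preimage.
    by apply: measurableI; exact: measurable_spin_sets.
  - by apply: measurableU => //; exact: measurable_wfst_preimage.
  move=> c [Fc [ctau ceta]]; have [Nc|Nc] := pselect (N c); [by right|left; split => //=].
  have h eta' : eta' != restr C c.2 ->
      hamiltonian R C c.1 c.2 < hamiltonian R C c.1 (Defs.glue C eta' c.2).
    by apply: contrapT => no; apply: Nc; apply: sub => /= hh; apply: no; exact: hh.
  rewrite /= /ground; case: forallP => // -[] eta'; apply/implyP => ne.
  have ext zeta : hamiltonian R C c.1 (Defs.glue C zeta (bc bd tau)) =
      hamiltonian R C c.1 (Defs.glue C zeta c.2).
    apply: eq_hamiltonian; apply: glue_ext => x xb xC.
    by rewrite /bc -ctau glue_in_restr // hbd.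
  rewrite !ext; have := h eta'; rewrite ceta => /(_ ne).
  have -> // : hamiltonian R C c.1 (Defs.glue C eta c.2) = hamiltonian R C c.1 c.2.
  by apply: eq_hamiltonian => x _; rewrite -ceta glue_restr.
apply: le_trans; first by apply: measureU2 => //; exact: measurable_wfst_preimage.
by rewrite [X in (_ + X <= _)%E](N0 : nu N = 0%E) adde0.
Qed.

(** Fixing couplings in [F] and spins on [bd], which lies outside [C], gives an event of the outer
    sigma-algebra, to which the Gibbs property applies. *)
Lemma EA_driven beta C bd : (forall x, x \in Cbar C -> x \notin C -> x \in bd) ->
  (forall x, x \in bd -> x \notin C) ->
  EA_spin_glass R beta nu -> driven C bd (gibbs R beta C).
Proof.
move=> hbd hC [_ ea]; split; first exact: measurable_gibbs.
move=> tau eta F mF.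
have mg := measurable_gibbs beta C (bc bd tau) eta.
have g0 w s : 0 <= gibbs R beta C w s eta.
  by rewrite /gibbs divr_ge0 ?expR_ge0 // sumr_ge0 // => *; exact: expR_ge0.
pose F' : set (ConfigSpace R) := @wfst R @^-1` F `&` [set c | restr bd c.2 = tau].
have oF : @outer_sigma R C F'.
  pose T := g_sigma_algebraType (@cyl_w R `|` @cyl_s_out R C).
  apply: (@measurableI _ T).
    rewrite -[X in measurable X]setTI.
    apply: (@measurable_to_couplings R _ T (@wfst R)) => // x b _ B mB; rewrite setTI.
    by apply: sub_sigma_algebra; left; exists x, b, B.
  apply: measurable_agree => x b xbd; apply: sub_sigma_algebra; right.
  by exists x, b; split => //; exact: hC.
have mF' : measurable F'.
  by apply: measurableI; [exact: measurable_wfst_preimage|exact: measurable_spin_sets].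
have -> : @wfst R @^-1` F `&` [set c | restr bd c.2 = tau /\ restr C c.2 = eta] =
    F' `&` [set c | restr C c.2 = eta] by rewrite /F' -setIA.
rewrite ea //; have -> : (\int[nu]_(c in F') (gibbs R beta C c.1 c.2 eta)%:E =
    \int[nu]_(c in F') (gibbs R beta C (wfst c) (bc bd tau) eta)%:E)%E.
  apply: eq_integral => c; rewrite inE => -[_ /= ctau]; congr EFin.
  have ext zeta : hamiltonian R C c.1 (Defs.glue C zeta (bc bd tau)) =
      hamiltonian R C c.1 (Defs.glue C zeta c.2).
    apply: eq_hamiltonian; apply: glue_ext => x xb xC.
    by rewrite /bc -ctau glue_in_restr // hbd.
  by rewrite /gibbs /wfst ext; congr (_ / _); apply: eq_bigr => zeta _; rewrite ext.
rewrite /rho /distribution ge0_integral_pushforward //; last 2 first.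
- by apply/measurable_EFinP; exact: measurable_funTS.
- by move=> w _; rewrite lee_fin.
(* Forgetting the event that the boundary spins equal [tau] enlarges the domain of integration. Only
   the law of the couplings is left, at the price of an inequality. *)
apply: ge0_subset_integral => //.
- exact: measurable_wfst_preimage.
- apply/measurable_EFinP/measurable_funTS; apply: (measurableT_comp mg).
  exact: measurable_wfst.
- by move=> c _; rewrite /= lee_fin.
- by move=> c [].
Qed.

End Driven.

Lemma card_seq_sub_le (T : choiceType) (s : seq T) : (#|{: seq_sub s}| <= size s)%N.
Proof.
rewrite cardT -(size_map val); apply: uniq_leq_size.
  by rewrite map_inj_uniq ?enum_uniq //; exact: val_inj.
by move=> _ /mapP[y _ ->]; exact: valP.
Qed.

(** * Two bounds for a fixed set of unsatisfied edges *)

Section FixedPath.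
Context {R : realType}.
Notation W := (JSpace R).
Variable nu : probability (ConfigSpace R) R.
Notation rho := (distribution nu (@wfst R)).
Hypothesis iid : iid_couplings rho.
Variables (C bd : seq Z2) (a eps : R).
Hypothesis hbd : forall x, x \in Cbar C -> x \notin C -> x \in bd.
Variable g : W -> (Z2 -> bool) -> {ffun seq_sub C -> bool} -> R.
Hypotheses (drv : driven nu C bd g) (low : low_temp C a eps g).
Implicit Types (E : seq edge) (D : set W) (s : Z2 -> bool).

(* Upper bound for the conditional probability that all of [E] is unsatisfied. *)
Definition unsat_weight E s (w : W) : R :=
  \sum_eta (unsat w (Defs.glue C eta s) E)%:R * g w s eta.

Lemma measurable_unsat_bool E s : measurable_fun setT (fun w : W => unsat w s E).
Proof.
rewrite /unsat; elim: E => [|e E IH] /=; first exact: measurable_cst.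
apply: measurable_and => //; apply: measurable_fun_ltr => //; rewrite /J.
do 2 apply: measurable_funM => //; exact: measurable_coupling.
Qed.

Lemma measurable_unsat_nat E s : measurable_fun setT (fun w : W => (unsat w s E)%:R : R).
Proof.
apply: (eq_measurable_fun (fun w : W => if unsat w s E then 1 else 0 : R)).
  by move=> w _; case: ifP.
by apply: measurable_fun_ifT => //; exact: measurable_unsat_bool.
Qed.

Lemma measurable_unsat_weight E s : measurable_fun setT (unsat_weight E s).
Proof.
apply: measurable_sum => eta; apply: measurable_funM; first exact: measurable_unsat_nat.
exact: (drv_measurable _ _ _ _ drv).
Qed.

Lemma unsat_weight_ge0 E s w : 0 <= unsat_weight E s w.
Proof. by apply: sumr_ge0 => eta _; rewrite mulr_ge0 ?ler0n ?(ltemp_ge0 _ _ _ _ low). Qed.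

Lemma measurable_unsat_config E : measurable [set c : ConfigSpace R | unsat c.1 c.2 E].
Proof.
elim: E => [|e E IH].
  by rewrite (_ : [set _ | _] = setT) //; apply/seteqP; split.
rewrite (_ : [set _ | _] = [set c : ConfigSpace R | J c.1 c.2 e < 0] `&`
    [set c : ConfigSpace R | unsat c.1 c.2 E]); last first.
  by apply/seteqP; split => c /=; [move=> /andP[]|move=> [h1 h2]; apply/andP].
apply: measurableI => //.
rewrite (_ : [set _ | _] = [set c : ConfigSpace R | exists b : bool * bool,
   (c.2 e.1 = b.1 /\ c.2 (edge_end e.1 e.2) = b.2) /\
     wfst c e.1 e.2 * spin R b.1 * spin R b.2 < 0]).
  apply: measurable_exists => -[b1 b2]; apply: measurableI; first apply: measurableI.
  - by apply: sub_sigma_algebra; right; exists e.1, b1.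
  - by apply: sub_sigma_algebra; right; exists (edge_end e.1 e.2), b2.
  apply: measurable_boolset; apply: measurable_fun_ltr => //.
  do 2 apply: measurable_funM => //.
  apply: (measurableT_comp (measurable_coupling e.1 e.2)); exact: measurable_wfst.
apply/seteqP; split => c /=.
  by move=> h; exists (c.2 e.1, c.2 (edge_end e.1 e.2)).
by move=> [[b1 b2] /= [[<- <-]]].
Qed.

(** The spins on [C] and [bd] decide whether [E] is unsatisfied. Counting every boundary condition
    with full weight removes the unknown dependence between boundary spins and couplings. *)
Lemma prob_unsat_le E D : {subset E <= eds C} -> measurable D ->
  (nu [set c : ConfigSpace R | unsat c.1 c.2 E /\ D c.1] <=
   \sum_(tau : {ffun seq_sub bd -> bool}) \int[rho]_(w in D) (unsat_weight E (bc bd tau) w)%:E)%E.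
Proof.
move=> sE mD; pose Fs (p : {ffun seq_sub bd -> bool} * {ffun seq_sub C -> bool}) : set (ConfigSpace R) :=
  @wfst R @^-1` (D `&` [set w | unsat w (Defs.glue C p.2 (bc bd p.1)) E]) `&`
    [set c | restr bd c.2 = p.1 /\ restr C c.2 = p.2].
have mDU p : measurable (D `&` [set w : W | unsat w (Defs.glue C p.2 (bc bd p.1)) E]).
  by apply: measurableI => //; apply: measurable_boolset; exact: measurable_unsat_bool.
apply: (@le_trans _ _ (\sum_p nu (Fs p))%E).
  apply: measure_fin_union.
  - apply: measurableI; first exact: measurable_unsat_config.
    exact: (measurable_wfst_preimage D mD).
  - move=> p; apply: measurableI; first exact: measurable_wfst_preimage.
    by apply: measurableI; exact: measurable_spin_sets.
  move=> c [/= hU Dc]; exists (restr bd c.2, restr C c.2); split => //; split => //=.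
  apply/allP => e eE; move/allP: hU => /(_ e eE).
  have /andP[e1 e2] : (e.1 \in Cbar C) && (edge_end e.1 e.2 \in Cbar C).
    by rewrite -mem_eds; exact: sE.
  have ext x : x \in Cbar C -> Defs.glue C (restr C c.2) (bc bd (restr bd c.2)) x = c.2 x.
    move=> xb; rewrite (glue_ext C _ _ c.2) ?glue_restr // => y yb yC.
    by rewrite /bc glue_in_restr // hbd.
  by rewrite /J !ext.
have mUg tau eta : measurable_fun setT
    (fun w : W => (unsat w (Defs.glue C eta (bc bd tau)) E)%:R * g w (bc bd tau) eta).
  by apply: measurable_funM; [exact: measurable_unsat_nat|exact: (drv_measurable _ _ _ _ drv)].
have Ug0 tau eta w : 0 <= (unsat w (Defs.glue C eta (bc bd tau)) E)%:R * g w (bc bd tau) eta.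
  by rewrite mulr_ge0 ?ler0n ?(ltemp_ge0 _ _ _ _ low).
rewrite -(pair_bigA _ (fun tau eta => nu (Fs (tau, eta)))) /=.
apply: lee_sum => tau _.
apply: (@le_trans _ _ (\sum_eta \int[rho]_(w in D)
    ((unsat w (Defs.glue C eta (bc bd tau)) E)%:R * g w (bc bd tau) eta)%:E)%E); last first.
  rewrite -ge0_integral_sum //.
  - by under [leRHS]eq_integral do rewrite /unsat_weight -sumEFin.
  - move=> eta; apply/measurable_EFinP/measurable_funTS; exact: mUg.
  - by move=> eta w _; rewrite lee_fin.
apply: lee_sum => eta _; apply: le_trans.
  by apply: (drv_le _ _ _ _ drv); exact: (mDU (tau, eta)).
rewrite (eq_integral (fun w : W => ((unsat w (Defs.glue C eta (bc bd tau)) E)%:R * g w (bc bd tau) eta)%:E)).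
  apply: ge0_subset_integral => //.
  - by apply/measurable_EFinP/measurable_funTS; exact: mUg.
  - by move=> w _; rewrite lee_fin.
by move=> w; rewrite inE => -[_ /= ->]; rewrite mul1r.
Qed.

(* All sign patterns of the couplings on [E] are equally likely, and a spin
   configuration determines the only pattern for which [E] is unsatisfied. *)
Lemma sum_unsat_weight_flip E s w : {subset E <= eds C} ->
  \sum_(m : {ffun seq_sub E -> bool})
     unsat_weight E s (flipw (fun e => if insub e is Some y then m y else false) w) <= 1.
Proof.
move=> sE; pose P (m : {ffun seq_sub E -> bool}) e := if insub e is Some y then m y else false.
rewrite exchange_big /=; apply: le_trans (ltemp_sum _ _ _ _ low w s).
apply: ler_sum => eta _; set t := Defs.glue C eta s.
have le1 m : (unsat (flipw (P m) w) t E)%:R * g (flipw (P m) w) s eta <=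
    (unsat (flipw (P m) w) t E)%:R * g w s eta.
  case: (boolP (unsat _ _ _)) => [/allP h|_]; last by rewrite !mul0r.
  rewrite !mul1r -{2}(flipwK (P m) w); apply: (ltemp_flip _ _ _ _ low) => e _ Pe.
  apply: h; move: Pe; rewrite /P; case: insubP => // y _ <- _; exact: valP.
apply: le_trans; first by apply: ler_sum => m _; exact: le1.
rewrite -mulr_suml; apply: ler_piMl; first exact: (ltemp_ge0 _ _ _ _ low).
have PE m y : P m (val y) = m y by rewrite /P valK.
have [[m hm]|no] := pselect (exists m, unsat (flipw (P m) w) t E); last first.
  rewrite big1 // => m _; case: (boolP (unsat _ _ _)) => // hm.
  by case: no; exists m.
rewrite (bigD1 m) //= hm big1 ?addr0 // => m' ne; case: (boolP (unsat _ _ _)) => // hm'.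
case/eqP: ne; apply/ffunP => y.
move/allP: hm => /(_ (val y) (valP y)); move/allP: hm' => /(_ (val y) (valP y)).
rewrite !J_flipw !PE; case: (m y); case: (m' y) => //; lra.
Qed.

(** The law of the couplings and [D] are invariant under the [2 ^ size E] sign flips on [E], so the
    flipped weights have equal integrals over [D]. As these weights sum to at most 1, each integral
    is at most [2 ^- size E] times the probability of [D]. *)
Lemma prob_unsat_flip E D : uniq E -> {subset E <= eds C} -> measurable D ->
  (forall P w, D (flipw P w) <-> D w) ->
  (nu [set c : ConfigSpace R | unsat c.1 c.2 E /\ D c.1] <=
   ((2 ^ size bd)%:R / 2 ^+ size E)%:E * rho D)%E.
Proof.
move=> uE sE mD hD; apply: le_trans; first exact: prob_unsat_le.
have wD tau : (\int[rho]_(w in D) (unsat_weight E (bc bd tau) w)%:E <= (2 ^- size E)%:E * rho D)%E.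
  set s := bc bd tau; pose P (m : {ffun seq_sub E -> bool}) e := if insub e is Some y then m y else false.
  have mG : measurable_fun setT (fun w : W => (unsat_weight E s w)%:E).
    by apply/measurable_EFinP; exact: measurable_unsat_weight.
  have flip m : (\int[rho]_(w in D) (unsat_weight E s (flipw (P m) w))%:E =
      \int[rho]_(w in D) (unsat_weight E s w)%:E)%E.
    by apply: (integral_flipw rho iid (P m) D (fun w => (unsat_weight E s w)%:E)) => // w;
      rewrite lee_fin unsat_weight_ge0.
  have n2 : #|{: {ffun seq_sub E -> bool}}| = (2 ^ size E)%N.
    by rewrite card_ffun card_bool card_seq_sub.
  rewrite -(@lee_pmul2l _ (2 ^+ size E)%:E) ?lte_fin ?exprn_gt0 // muleA -EFinM divff ?mul1e; last first.
    by rewrite expf_neq0.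
  have -> : ((2 ^+ size E)%:E * \int[rho]_(w in D) (unsat_weight E s w)%:E =
      \sum_m \int[rho]_(w in D) (unsat_weight E s (flipw (P m) w))%:E)%E.
    by rewrite (eq_bigr _ (fun m _ => flip m)) sume_const_card n2 natrX.
  rewrite -ge0_integral_sum //; last 2 first.
  - move=> m; apply: measurable_funTS; apply: (measurableT_comp mG); exact: measurable_flipw.
  - by move=> m w _; rewrite lee_fin unsat_weight_ge0.
  rewrite -[leRHS]mul1e -integral_cst //; apply: ge0_le_integral => //.
  - by move=> w _; rewrite sume_ge0 // => m _; rewrite lee_fin unsat_weight_ge0.
  - apply: emeasurable_sum => m; apply: measurable_funTS; apply: (measurableT_comp mG).
    exact: measurable_flipw.
  - by move=> w _; rewrite sumEFin lee_fin; exact: sum_unsat_weight_flip.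
apply: (@le_trans _ _ (\sum_(tau : {ffun seq_sub bd -> bool}) (2 ^- size E)%:E * rho D)%E).
  by apply: lee_sum => tau _.
rewrite sume_const_card muleA -EFinM; apply: lee_wpmul2r => //.
rewrite lee_fin ler_wpM2r // ?invr_ge0 ?exprn_ge0 // ler_nat card_ffun card_bool leq_exp2l //.
exact: card_seq_sub_le.
Qed.

(* If unsatisfied [E] leaves room for lowering the energy by [2 * a * k], then
   it is unlikely whatever the boundary condition. *)
Lemma prob_unsat_gain E D k : 0 <= eps -> {subset E <= eds C} -> measurable D ->
  (forall w, D w -> exists2 f : Z2 -> bool, (forall x, f x -> x \in C) &
     forall s, unsat w s E ->
       hamiltonian R C w (sxor s f) <= hamiltonian R C w s - 2 * a * k%:R) ->
  (nu [set c : ConfigSpace R | unsat c.1 c.2 E /\ D c.1] <=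
   ((2 ^ size bd)%:R * eps ^+ k)%:E)%E.
Proof.
move=> e0 sE mD hD; apply: le_trans; first exact: prob_unsat_le.
have pt s w : D w -> unsat_weight E s w <= eps ^+ k.
  (* Flipping the spins of [f] permutes the configurations on [C], so the weights compared with
     still sum to at most 1. *)
  move=> /hD [f fC gain]; pose phi (eta : {ffun seq_sub C -> bool}) := [ffun y => eta y (+) f (val y)].
  have phiK : involutive phi by move=> eta; apply/ffunP => y; rewrite !ffunE addbK.
  apply: (@le_trans _ _ (\sum_eta eps ^+ k * g w s (phi eta))).
    apply: ler_sum => eta _; case: (boolP (unsat _ _ _)) => [hU|_]; last first.
      by rewrite mul0r mulr_ge0 ?exprn_ge0 // (ltemp_ge0 _ _ _ _ low).
    rewrite mul1r; apply: (ltemp_gain _ _ _ _ low); apply: le_trans (gain _ hU).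
    by rewrite (eq_hamiltonian _ _ _ (Defs.glue C (phi eta) s)) // => x _; exact: glue_sxor.
  have <- : \sum_eta eps ^+ k * g w s eta = \sum_eta eps ^+ k * g w s (phi eta).
    by rewrite (reindex_inj (inv_inj phiK)).
  rewrite -mulr_sumr.
  by rewrite ler_piMr ?exprn_ge0 // (ltemp_sum _ _ _ _ low).
apply: (@le_trans _ _ (\sum_(tau : {ffun seq_sub bd -> bool}) (eps ^+ k)%:E)%E).
  apply: lee_sum => tau _; apply: (@le_trans _ _ (\int[rho]_(w in D) (cst (eps ^+ k)%:E w))%E).
    apply: ge0_le_integral => //.
    - by move=> w _; rewrite lee_fin unsat_weight_ge0.
    - by apply/measurable_EFinP/measurable_funTS; exact: measurable_unsat_weight.
    - by move=> w Dw; rewrite lee_fin; exact: pt.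
  rewrite integral_cst // -[leRHS]mule1; apply: lee_wpmul2l; first by rewrite lee_fin exprn_ge0.
  exact: (probability_le1 rho mD).
rewrite sume_const_card -EFinM lee_fin ler_wpM2r ?exprn_ge0 // ler_nat card_ffun card_bool leq_exp2l //.
exact: card_seq_sub_le.
Qed.

End FixedPath.

(** * Cutting paths into segments *)

Section Segments.
Context {R : realType}.
Variables (L r : nat).
Implicit Types (u : Z2) (w : Z2 -> bool -> R) (p : (r * L).-tuple dir) (j : 'I_r).

Definition seg p j : L.-tuple dir := [tuple nth (true, true) p (j * L + k)%N | k < L].
Definition start u p j : Z2 := wend u (take (j * L) p).

Lemma take_seg p j : take (j.+1 * L) p = take (j * L) p ++ seg p j.
Proof.
rewrite mulSn addnC takeD; congr cat.
have sz : size (drop (j * L) p) = ((r - j) * L)%N by rewrite size_drop size_tuple mulnBl.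
have sL : (L <= (r - j) * L)%N by rewrite leq_pmull // subn_gt0.
apply: (@eq_from_nth _ (true, true)) => [|k]; first by rewrite size_takel ?sz // size_tuple.
rewrite size_takel ?sz // => kL; rewrite nth_take // nth_drop.
by rewrite -[k]/(val (Ordinal kL)) nth_mktuple.
Qed.

Lemma split_seg p j : exists s, p = (take (j * L) p ++ seg p j) ++ s :> seq dir.
Proof. by exists (drop (j.+1 * L) p); rewrite -take_seg cat_take_drop. Qed.

Lemma saw_seg u p j : saw u p -> saw (start u p j) (seg p j).
Proof.
have [s e] := split_seg p j; rewrite e => /saw_cat[/saw_cat[_ h] _].
exact: h.
Qed.

Lemma start_near u p j : near (r * L) u (start u p j).
Proof.
apply: near_leq (wend_near u (take (j * L) p)); rewrite size_take_min size_tuple.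
exact: geq_minr.
Qed.

Lemma wedges_seg u p j : {subset wedges (start u p j) (seg p j) <= wedges u p}.
Proof.
have [s e] := split_seg p j; move=> x h; rewrite e !wedges_cat !mem_cat.
by rewrite -/(start u p j) h orbT.
Qed.

Lemma start_inj u p : (0 < L)%N -> saw u p -> injective (start u p).
Proof.
move=> L0 sp; suff lt (i j : 'I_r) : (i < j)%N -> start u p i != start u p j.
  move=> i j e; apply/val_inj; case: (ltngtP i j) => // /lt; rewrite e eqxx //.
move=> ij; have e : p = (take (i * L) p ++ drop (i * L) p) :> seq dir by rewrite cat_take_drop.
have e2 : take (j * L) p = take (i * L) p ++ take ((j - i) * L) (drop (i * L) p).
  by rewrite -takeD mulnBl subnKC // leq_mul2r (ltnW ij) orbT.
rewrite /start e2 wend_cat; set v := wend u _.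
move: sp; rewrite {1}e => /saw_cat[_]; rewrite -/v.
set q := drop _ _; rewrite -{1}(cat_take_drop ((j - i) * L) q) => /saw_cat[+ _].
have : (0 < size (take ((j - i) * L) q))%N.
  rewrite size_take_min size_drop size_tuple leq_min muln_gt0 subn_gt0 ij L0 /=.
  by rewrite subn_gt0 ltn_mul2r L0 ltn_ord.
case: (take _ q) => //= s t _ /andP[h _]; apply: contra h => /eqP ev; rewrite {1}ev.
exact: (wend_wpos (dstep v s) t).
Qed.

(** Competitors have the same number of steps, which keeps the condition local; strictness makes a
    good segment unique for its ends. *)
Definition good w u (p : L.-tuple dir) : bool :=
  [forall q : L.-tuple dir, [&& saw u q, wend u q == wend u p & q != p] ==>
     (len w (wedges u p) < len w (wedges u q))].

Lemma good_unique w u (p q : L.-tuple dir) : saw u p -> saw u q -> wend u p = wend u q ->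
  good w u p -> good w u q -> p = q.
Proof.
move=> sp sq epq /forallP/(_ q) hp /forallP/(_ p) hq; apply/eqP/negPn/negP => ne.
move: hp hq; rewrite sp sq epq eqxx ne eq_sym ne /= => h1 h2.
by have := lt_trans h1 h2; rewrite ltxx.
Qed.

Definition steps (p : L.-tuple dir) (s : dir) : 'I_L.+1 := inord (count_mem s p).

(** The numbers of steps in the four directions determine the displacement and take polynomially
    many values in [L], against [4 ^ L] words. *)
Definition counts (p : L.-tuple dir) : {ffun dir -> 'I_L.+1} := [ffun s => steps p s].

Lemma wend_counts u (p : seq dir) : wend u p =
  vadd u ((count_mem (false, true) p)%:Z - (count_mem (false, false) p)%:Z,
          (count_mem (true, true) p)%:Z - (count_mem (true, false) p)%:Z).
Proof.
elim: p u => [|s p IH] u; first by case: u => x y; rewrite /vadd /= !subrr !addr0.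
rewrite [wend _ _]/= -/(wend _ _) IH; case: u => x y.
by case: s => [[] []]; rewrite /vadd /dstep /dual_other_end /vadd /= ; congr pair; lia.
Qed.

Lemma counts_wend u (p q : L.-tuple dir) : counts p = counts q -> wend u p = wend u q.
Proof.
move=> /ffunP e; rewrite !wend_counts.
have cl (t : L.-tuple dir) s : (count_mem s t < L.+1)%N.
  by rewrite ltnS; have := count_size (pred1 s) t; rewrite size_tuple.
have H s : count_mem s p = count_mem s q.
  by have := e s; rewrite !ffunE => /(congr1 val); rewrite /= !inordK.
by rewrite !H.
Qed.

(** A good segment can be recovered from its start and displacement, so a cheap code suffices; a bad
    one has to be spelled out. *)
Definition seg_code w u p j : L.-tuple dir + {ffun dir -> 'I_L.+1} :=
  if good w (start u p j) (seg p j) then inr (counts (seg p j)) else inl (seg p j).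

(** Decoding goes from left to right: the earlier segments give the start of the next one, which its
    code then determines. *)
Lemma seg_code_inj w u (p q : (r * L).-tuple dir) : saw u p -> saw u q ->
  (forall j, seg_code w u p j = seg_code w u q j) -> p = q.
Proof.
move=> sp sq e; apply: val_inj => /=.
rewrite -(take_size p) -(take_size q) !size_tuple.
suff H k : (k <= r)%N -> take (k * L) p = take (k * L) q by exact: H.
elim: k => [|k IH] kr; first by rewrite !mul0n !take0.
have {IH}IH := IH (ltnW kr); pose j := Ordinal kr.
rewrite -[k.+1]/((j : nat).+1) !take_seg -[nat_of_ord j]/k IH.
congr cat; suff -> : seg p j = seg q j by [].
have es : start u p j = start u q j by rewrite /start /= IH.
have := e j; rewrite /seg_code es; case: ifP => gp; case: ifP => gq ec; [|by []|by []|exact: (congr1 (fun x => if x is inl y then y else seg p j) ec)].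
have hc : counts (seg p j) = counts (seg q j) by case: ec.
apply: (good_unique w (start u q j)) => //; first by rewrite -es; exact: saw_seg.
  exact: saw_seg.
exact: counts_wend.
Qed.

End Segments.

(** The witness is the most frequent value of [f] on [S]; [c0] shows that [K] is inhabited. *)
Lemma pigeonhole_set (I K : finType) (f : I -> K) (S : {set I}) (c0 : K) :
  exists c, (#|S| <= #|K| * #|[pred i in S | f i == c]|)%N.
Proof.
pose n c := #|[pred i in S | f i == c]|.
exists [arg max_(c > c0) n c]; case: arg_maxnP => // c _ max.
rewrite -sum1_card (partition_big f predT) //=.
apply: (@leq_trans (\sum_(d : K) n c)%N); last by rewrite sum_nat_const.
apply: leq_sum => d _; apply: leq_trans (max d isT).
by rewrite sum1_card /n; apply: eq_leq; apply: eq_card => i; rewrite !inE.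
Qed.

Definition is_inl {A B : Type} (x : A + B) : bool := if x is inl _ then true else false.

(* Weighting each left letter by [1 / #|A|] turns the count into a product. *)
Lemma card_few_inl (I A B : finType) k : (0 < #|A|)%N ->
  (#|[pred c : {ffun I -> A + B} | #|[pred i | is_inl (c i)]| <= k]| <=
   #|A| ^ k * (1 + #|B|) ^ #|I|)%N.
Proof.
move=> A0; rewrite -(ler_nat rat) natrM !natrX natrD.
have a1 : 1 <= #|A|%:R :> rat by rewrite ler1n.
have a0 : #|A|%:R != 0 :> rat by rewrite pnatr_eq0 -lt0n.
pose z (x : A + B) : rat := if is_inl x then #|A|%:R^-1 else 1.
have z0 x : 0 <= z x by rewrite /z; case: ifP => // _; rewrite invr_ge0 ler0n.
have -> : (1%:R + #|B|%:R : rat) = \sum_x z x.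
  rewrite big_sumType /= /z /= !sumr_const -[_ *+ #|A|]mulr_natl mulfV //.
have -> : (\sum_x z x) ^+ #|I| = \sum_(c : {ffun I -> A + B}) \prod_i z (c i).
  by rewrite -(bigA_distr_bigA (fun _ => z)) prodr_const cardT.
rewrite -sum1_card natr_sum mulr_sumr [leLHS]big_mkcond /=.
apply: ler_sum => c _; rewrite inE; case: ifP => [le|_]; last first.
  by rewrite mulr_ge0 ?exprn_ge0 ?ler0n // prodr_ge0.
have -> : \prod_i z (c i) = #|A|%:R ^- #|[pred i | is_inl (c i)]|.
  rewrite /z -big_mkcond /= prodr_const exprVn; congr (_ ^- _).
by rewrite ler_pdivlMr ?exprn_gt0 ?ltr0n // mul1r ler_weXn2l.
Qed.

(** Residues modulo [2 * L + 1]: distinct points of one colour are more than [2 * L] apart, so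
    [L]-step walks from them stay disjoint. *)
Definition color L (v : Z2) : 'I_(L + L).+1 * 'I_(L + L).+1 :=
  (inord `|(v.1 %% (L + L).+1%:Z)%Z|%N, inord `|(v.2 %% (L + L).+1%:Z)%Z|%N).

Lemma color_coord L (x y : int) :
  inord `|(x %% (L + L).+1%:Z)%Z|%N = inord `|(y %% (L + L).+1%:Z)%Z|%N :> 'I_(L + L).+1 ->
  `|x - y| <= (L + L)%:Z -> x = y.
Proof.
set d := (L + L).+1; have d0 : d%:Z != 0 by [].
have lt z : (`|(z %% d%:Z)%Z|%N < d)%N.
  by rewrite -ltz_nat gez0_abs ?modz_ge0 // ltz_pmod.
move=> /(congr1 val); rewrite /= !inordK // => h le.
have {}h : (x %% d%:Z)%Z = (y %% d%:Z)%Z.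
  by rewrite -(gez0_abs (modz_ge0 x d0)) h gez0_abs // modz_ge0.
have /eqP := h; rewrite eqz_mod_dvd => dv; apply/eqP; rewrite -subr_eq0.
apply/negPn/negP => ne; have : (d <= `|x - y|%N)%N.
  by apply: dvdn_leq; [rewrite absz_gt0|exact: dv].
by move: le; rewrite /d; lia.
Qed.

Lemma color_far L (u v : Z2) : color L u = color L v -> near (L + L) u v -> u = v.
Proof.
case: u v => [a b] [c d] [e1 e2] /andP[/= n1 n2]; congr pair.
  by apply/esym/(color_coord L) => //; rewrite e1.
by apply/esym/(color_coord L) => //; rewrite e2.
Qed.

(** * Families of paths started at well separated centres *)

Section Families.
Context {R : realType}.
Variables (L r : nat) (T : finType) (cen : T -> Z2) (C : seq Z2) (a : R).
Hypothesis L0 : (0 < L)%N.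
Hypothesis sep : forall t t', t != t' -> ~~ near (r * L + r * L) (cen t) (cen t').
Hypothesis inC : forall t x, near (r * L + L) (cen t) x -> x \in C.
Notation family := {ffun T -> (r * L).-tuple dir}.
Notation I := (T * 'I_r)%type.
Implicit Types (G : family) (w : Z2 -> bool -> R) (i : I).

Definition fstart G i : Z2 := start L r (cen i.1) (G i.1) i.2.
Definition fseg G i : L.-tuple dir := seg L r (G i.1) i.2.
Definition fedges G : seq edge := flatten [seq wedges (cen t) (G t) | t <- enum T].
Definition admissible G : bool := [forall t, saw (cen t) (G t)].

Lemma mem_Cbar x : x \in C -> x \in Cbar C.
Proof. by move=> xC; rewrite mem_undup mem_cat xC. Qed.

Lemma edge_in_eds t (e : edge) : near (r * L + L) (cen t) e.1 -> e \in eds C.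
Proof.
move=> /inC eC; rewrite mem_eds mem_Cbar //= mem_undup mem_cat; apply/orP; right.
apply/flattenP; exists (nbrs e.1); first exact: map_f.
by rewrite /edge_end /unitv; case: e.2; rewrite !inE eqxx ?orbT.
Qed.

Lemma fseg_saw G i : admissible G -> saw (fstart G i) (fseg G i).
Proof. by move=> /forallP/(_ i.1); exact: saw_seg. Qed.

Lemma fstart_word_eds G i (q : L.-tuple dir) : {subset wedges (fstart G i) q <= eds C}.
Proof.
move=> e /wedges_near; rewrite size_tuple => h; apply: (edge_in_eds i.1).
exact: near_trans (start_near _ _ _ _ _) h.
Qed.

Lemma fseg_edges G i : {subset wedges (fstart G i) (fseg G i) <= fedges G}.
Proof.
move=> e he; apply/flattenP; exists (wedges (cen i.1) (G i.1)).
  by apply: map_f; rewrite mem_enum.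
exact: wedges_seg he.
Qed.

Lemma fedges_eds G : {subset fedges G <= eds C}.
Proof.
move=> e /flattenP[_ /mapP[t _ ->]] /wedges_near; rewrite size_tuple => h.
by apply: (edge_in_eds t); apply: near_leq h; rewrite leq_addr.
Qed.

Lemma size_fedges G : size (fedges G) = (r * L * #|T|)%N.
Proof.
rewrite size_flatten /shape -map_comp (eq_map (g := fun=> (r * L)%N)) => [|t /=].
  by rewrite sumnE big_map big_enum sum_nat_const mulnC.
by rewrite size_wedges size_tuple.
Qed.

Lemma uniq_fedges G : admissible G -> uniq (fedges G).
Proof.
move=> /forallP adm; rewrite /fedges; have := enum_uniq T.
elim: (enum T) => //= t s IH /andP[ts us]; rewrite cat_uniq saw_uniq_wedges // IH // andbT /=.
apply/hasPn => e /flattenP[_ /mapP[t' t's ->]] /wedges_near h'.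
apply/negP => /wedges_near h; rewrite !size_tuple in h h'.
have tt : t != t' by apply: contraNneq ts => ->.
have := sep _ _ tt; rewrite (near_trans _ _ _ e.1) //.
by rewrite near_sym.
Qed.

Lemma fstart_inj G : admissible G -> injective (fstart G).
Proof.
move=> /forallP adm [t j] [t' j'] e; have [tt|ne] := eqVneq t t'.
  by subst t'; congr pair; exact: (start_inj L r (cen t) (G t) L0 (adm t)).
have := sep _ _ ne; rewrite (near_trans _ _ _ (fstart G (t, j))) //; first exact: start_near.
by rewrite e near_sym; exact: start_near.
Qed.

Definition fbad w G : {set I} := [set i | ~~ good L w (fstart G i) (fseg G i)]%SET.

Definition far_set G (S : {set I}) : bool :=
  [forall i in S, forall j in S, (i != j) ==> ~~ near (L + L) (fstart G i) (fstart G j)].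

Definition shorter w G i : bool := [exists q : L.-tuple dir,
  [&& saw (fstart G i) q, wend (fstart G i) q == wend (fstart G i) (fseg G i) &
   len w (wedges (fstart G i) q) + a <= len w (wedges (fstart G i) (fseg G i))]].

Definition few_bad k w G : bool := (#|fbad w G| <= k)%N.

Definition far_family k (P : I -> Prop) G : Prop :=
  exists2 S : {set I}, far_set G S && (k <= #|S|)%N & forall i, i \in S -> P i.

(** The number of colours of a starting point, times 2 for the reason why a segment is bad: a near
    tie or a clearly shorter competitor. *)
Definition ncol : nat := ((L + L).+1 * (L + L).+1 * 2)%N.

Lemma bad_cases w G i : admissible G -> i \in fbad w G ->
  near_tie L a (fstart G i) w \/ shorter w G i.
Proof.
move=> adm; rewrite inE => /forallPn[q]; rewrite negb_imply -leNgt => /andP[/and3P[sq /eqP eq ne] le].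
have [lt|ge] := ltP (len w (wedges (fstart G i) (fseg G i)) - len w (wedges (fstart G i) q)) a.
  left; exists (q, fseg G i); rewrite ne sq fseg_saw //= distrC ger0_norm // subr_ge0 //.
by right; apply/existsP; exists q; rewrite sq eq eqxx /= -lerBrDl.
Qed.

(** Among more than [ncol * k] bad segments, at least [k] share both colour and reason; distinct
    starts of one colour are far apart. *)
Lemma bad_trichotomy w G k : admissible G ->
  [\/ few_bad (ncol * k) w G, far_family k (fun i => near_tie L a (fstart G i) w) G |
      far_family k (fun i => shorter w G i) G].
Proof.
move=> adm; have [le|lt] := leqP #|fbad w G| (ncol * k); first by apply: Or31.
pose f i := (color L (fstart G i), `[< near_tie L a (fstart G i) w >]).
have [[c b] hc] := pigeonhole_set _ _ f (fbad w G) (ord0, ord0, true).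
pose S : {set I} := [set i in fbad w G | f i == (c, b)]%SET.
have cS : (k <= #|S|)%N.
  have -> : #|S| = #|[pred i in fbad w G | f i == (c, b)]| by apply: eq_card => i; rewrite !inE.
  have := leq_trans lt hc; rewrite !card_prod !card_ord card_bool /ncol ltn_mul2l => /andP[_ /ltnW //].
have fS : far_set G S.
  apply/forall_inP => i; rewrite inE => /andP[_ /eqP ei]; apply/forall_inP => j.
  rewrite inE => /andP[_ /eqP ej]; apply/implyP; apply: contra => h.
  apply/eqP/(fstart_inj G adm); apply: (color_far L) => //.
  exact: (congr1 fst (etrans ei (esym ej))).
case: b @S cS fS hc => S cS fS _.
  apply: Or32; exists S; first by rewrite fS.
  by move=> i; rewrite inE => /andP[_ /eqP/(congr1 snd)/= /asboolP].
apply: Or33; exists S; first by rewrite fS.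
move=> i; rewrite inE => /andP[ib /eqP/(congr1 snd)/= /asboolPn no].
by case: (bad_cases w G i adm ib).
Qed.

(** For fixed couplings the segment codes determine an admissible family, and at most [k] of them
    are spelled out words. *)
Lemma card_few_bad k w : (#|[pred G : family | admissible G & few_bad k w G]| <=
   #|{: L.-tuple dir}| ^ k * (1 + #|{: {ffun dir -> 'I_L.+1}}|) ^ #|{: I}|)%N.
Proof.
pose code G : {ffun I -> L.-tuple dir + {ffun dir -> 'I_L.+1}} :=
  [ffun i => seg_code L r w (cen i.1) (G i.1) i.2].
apply: leq_trans (card_few_inl I _ _ k _); last first.
  by apply/card_gt0P; exists [tuple (true, true) | _ < L].
rewrite -(card_in_image (f := code)); last first.
  move=> G G'; rewrite !inE => /andP[/forallP adm _] /andP[/forallP adm' _] /ffunP e.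
  apply/ffunP => t; apply: (seg_code_inj L r w (cen t)) => // j.
  by have := e (t, j); rewrite !ffunE.
rewrite subset_leq_card //; rewrite subset_all; apply/allP => c.
move=> /mapP[G]; rewrite mem_enum inE => /andP[_ few] ->.
rewrite inE; apply: leq_trans few; apply: eq_leq; apply: eq_card => i.
by rewrite !inE ffunE /seg_code -/(fstart G i) -/(fseg G i); case: ifP.
Qed.

(** The regions are flipped one after another. Earlier flips affect only edges near their own
    segments, so the next segment is still unsatisfied and the gains of [2 * a] add up. *)
Lemma shorter_gain w G (S : {set I}) : 0 < a -> admissible G -> far_set G S ->
  (forall i, i \in S -> shorter w G i) ->
  exists2 f : Z2 -> bool, (forall x, f x -> x \in C) &
    forall s, unsat w s (fedges G) ->
      hamiltonian R C w (sxor s f) <= hamiltonian R C w s - 2 * a * #|S|%:R.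
Proof.
move=> a0 adm far hS.
(* The induction also records where [f] changes value, in order to see that the remaining segments
   are left alone. *)
suff H (l : seq I) : uniq l -> {subset l <= S} ->
    exists f : Z2 -> bool, [/\ (forall x, f x -> x \in C),
      (forall e : edge, f e.1 (+) f (edge_end e.1 e.2) ->
         exists2 i, i \in l & near L (fstart G i) e.1) &
      forall s, unsat w s (fedges G) ->
        hamiltonian R C w (sxor s f) <= hamiltonian R C w s - 2 * a * (size l)%:R].
  have [//|f [f1 _ f3]] := H (enum S) (enum_uniq _) _; first by move=> i; rewrite mem_enum.
  by exists f => // s hs; rewrite cardE; exact: f3.
elim: l => [|i l IH] /=.
  move=> _ _; exists (fun=> false); split => // s _; rewrite mulr0 subr0.
  by rewrite (eq_hamiltonian _ _ _ s) // => x _; rewrite /sxor addbF.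
move=> /andP[il ul] sub.
have iS : i \in S by apply: sub; rewrite inE eqxx.
have [|f [f1 f2 f3]] := IH ul; first by move=> j jl; apply: sub; rewrite inE jl orbT.
have /existsP[q /and3P[sq /eqP eq le]] := hS i iS.
set u := fstart G i in sq eq le *; set p := fseg G i in eq le.
have sp : saw u p by exact: fseg_saw.
have up := saw_uniq_wedges _ _ sp; have uq := saw_uniq_wedges _ _ sq.
exists (fun x => f x (+) region u p q x); split.
- move=> x; case: (boolP (f x)) => [/f1 //|_] /= hr; apply: (inC i.1).
  apply: near_trans (start_near _ _ _ _ _) _.
  by apply: (region_near u p q) hr => //; rewrite size_tuple.
- move=> [x d] /=; rewrite addbACA (region_edge u p q) //.
  case: (boolP (f x (+) f (edge_end x d))) => [/(f2 (x, d)) [j jl hj] _|_].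
    by exists j => //; rewrite inE jl orbT.
  move=> /= h; exists i; first by rewrite inE eqxx.
  have : ((x, d) \in wedges u p) || ((x, d) \in wedges u q) by move: h; do 2 case: (_ \in _).
  by move=> /orP[] /wedges_near; rewrite size_tuple.
move=> s hs; have := f3 s hs.
have hp : unsat w (sxor s f) (wedges u p).
  apply/allP => e ep; rewrite J_sxor.
  case: (boolP (f e.1 (+) f (edge_end e.1 e.2))) => [/f2 [j jl hj]|_]; last first.
    by rewrite expr0 mul1r; move/allP: hs; apply; exact: (fseg_edges G i).
  have ij : i != j by apply: contraNneq il => ->.
  have jS : j \in S by apply: sub; rewrite inE jl orbT.
  have := implyP (forall_inP (forall_inP far i iS) j jS) ij; rewrite (near_trans _ _ _ e.1) //.
    by have := wedges_near _ _ _ ep; rewrite size_tuple.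
  by rewrite near_sym.
have := hamiltonian_region C w (sxor s f) u p q up uq (esym eq)
  (fstart_word_eds G i p) (fstart_word_eds G i q) hp.
have -> : hamiltonian R C w (sxor (sxor s f) (region u p q)) =
    hamiltonian R C w (sxor s (fun x => f x (+) region u p q x)).
  by apply: eq_hamiltonian => x _; rewrite /sxor addbA.
rewrite -natr1; move: le; nra.
Qed.

End Families.

Lemma measurable_imply d (T : measurableType d) (b : bool) (A : set T) :
  measurable A -> measurable [set t | b -> A t].
Proof.
move=> mA; case: b.
  by rewrite (_ : [set t | true -> A t] = A) //; apply/seteqP; split => t /=; [exact|].
by rewrite (_ : [set t | false -> A t] = setT) //; apply/seteqP; split.
Qed.

(** The sum of the probabilities is the expected number of events that occur. *)
Lemma sum_prob_le_card d (T : measurableType d) (R : realType) (mu : probability T R)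
    (I : finType) (P : pred I) (D : I -> set T) (n : nat) :
  (forall i, measurable (D i)) ->
  (forall t, (#|[pred i | P i & `[< D i t >]]| <= n)%N) ->
  (\sum_(i | P i) mu (D i) <= n%:R%:E)%E.
Proof.
move=> mD le.
have m1 i : measurable_fun setT (fun t => (\1_(D i) t)%:E : \bar R).
  by apply/measurable_EFinP; exact: measurable_indic.
have -> : (\sum_(i | P i) mu (D i) = \int[mu]_t \sum_(i | P i) (\1_(D i) t)%:E)%E.
  under [RHS]eq_integral do rewrite -big_filter.
  rewrite ge0_integral_sum //.
  by rewrite big_filter; apply: eq_bigr => i _; rewrite integral_indic // setIT.
rewrite -[leRHS]mule1 -(probability_setT mu) -integral_cst //; apply: ge0_le_integral => //.
- by move=> t _; apply: sume_ge0 => i _; rewrite lee_fin.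
- apply: (eq_measurable_fun (fun t => \sum_(i <- [seq i <- index_enum I | P i]) (\1_(D i) t)%:E)%E).
    by move=> t _; rewrite big_filter.
  exact: emeasurable_sum.
move=> t _; rewrite sumEFin lee_fin /=; apply: le_trans (_ : _ <= #|[pred i | P i & `[< D i t >]]|%:R) _; last first.
  by rewrite ler_nat.
rewrite -sum1_card natr_sum big_mkcondr /=.
apply: ler_sum => i _; rewrite indicE; case: asboolP => h; first by rewrite mem_set.
by rewrite memNset.
Qed.

(** * Paths in many boxes *)

Section MainBound.
Context {R : realType}.
Notation W := (JSpace R).
Variable nu : probability (ConfigSpace R) R.
Notation rho := (distribution nu (@wfst R)).
Hypothesis iid : iid_couplings rho.
Variables (C bd : seq Z2) (a eps : R).
Hypothesis hbd : forall x, x \in Cbar C -> x \notin C -> x \in bd.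
Variable g : W -> (Z2 -> bool) -> {ffun seq_sub C -> bool} -> R.
Hypotheses (drv : driven nu C bd g) (low : low_temp C a eps g).
Hypotheses (a0 : 0 < a) (eps0 : 0 <= eps).
Variables (L r : nat) (T : finType) (cen : T -> Z2).
Hypothesis L0 : (0 < L)%N.
Hypothesis sep : forall t t', t != t' -> ~~ near (r * L + r * L) (cen t) (cen t').
Hypothesis inC : forall t x, near (r * L + L) (cen t) x -> x \in C.
Notation family := {ffun T -> (r * L).-tuple dir}.
Notation I := (T * 'I_r)%type.
Implicit Types (G : family).

Lemma measurable_good u p : measurable_fun setT (fun w : W => good L w u p).
Proof.
apply: (measurable_fun_bool true) => //; rewrite setTI.
rewrite (_ : _ @^-1` _ = [set w : W | forall q : L.-tuple dir,
    [&& saw u q, wend u q == wend u p & q != p] ==>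
     (len w (wedges u p) < len w (wedges u q))]).
  apply: measurable_forall => q; apply: measurable_boolset.
  case: (_ && _) => /=; last exact: measurable_cst.
  by apply: measurable_fun_ltr; exact: measurable_len.
by apply/seteqP; split => w /forallP.
Qed.

Lemma measurable_few_bad k G : measurable [set w : W | few_bad L r T cen k w G].
Proof.
rewrite (_ : [set _ | _] = [set w : W | exists S : {set I}, (#|S| <= k)%N /\
    forall i, if i \in S then ~~ good L w (fstart L r T cen G i) (fseg L r T G i)
              else good L w (fstart L r T cen G i) (fseg L r T G i)]).
  apply: measurable_exists => S; apply: measurableI.
    by apply: measurable_boolset; exact: measurable_cst.
  apply: measurable_forall => i; apply: measurable_boolset; case: (i \in S) => /=.
    by apply: measurable_neg; exact: measurable_good.
  exact: measurable_good.
apply/seteqP; split => w /=.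
  move=> h; exists (fbad L r T cen w G); split => // i; rewrite inE.
  by case: (boolP (good _ _ _ _)).
move=> [S [cS hS]]; rewrite /few_bad (_ : fbad _ _ _ _ _ _ = S) //.
by apply/setP => i; rewrite inE; have := hS i; case: (i \in S) => [//|->].
Qed.

Lemma measurable_far_family k (P : I -> set W) G : (forall i, measurable (P i)) ->
  measurable [set w : W | far_family L r T cen k (fun i => P i w) G].
Proof.
move=> mP; rewrite (_ : [set _ | _] = [set w : W | exists S : {set I},
    (far_set L r T cen G S && (k <= #|S|)%N) /\ forall i, i \in S -> P i w]).
  apply: measurable_exists => S; apply: measurableI.
    by apply: measurable_boolset; exact: measurable_cst.
  by apply: measurable_forall => i; apply: measurable_imply.
by apply/seteqP; split => w /=; [move=> [S h1 h2]|move=> [S [h1 h2]]]; exists S.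
Qed.

Lemma measurable_shorter G i : measurable [set w : W | shorter L r T cen a w G i].
Proof.
rewrite (_ : [set _ | _] = [set w : W | exists q : L.-tuple dir,
  [&& saw (fstart L r T cen G i) q,
      wend (fstart L r T cen G i) q == wend (fstart L r T cen G i) (fseg L r T G i) &
   len w (wedges (fstart L r T cen G i) q) + a <=
   len w (wedges (fstart L r T cen G i) (fseg L r T G i))]]).
  apply: measurable_exists => q; apply: measurable_boolset.
  do 2 (apply: measurable_and; first exact: measurable_cst).
  apply: measurable_fun_ler; last exact: measurable_len.
  by apply: measurable_funD => //; exact: measurable_len.
by apply/seteqP; split => w /existsP.
Qed.

(** Goodness depends on the couplings through [|w e|] only, so it can be combined with the sign flip
    bound. *)
Lemma few_bad_flip k G P (w : W) : few_bad L r T cen k (flipw P w) G = few_bad L r T cen k w G.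
Proof.
rewrite /few_bad; congr (_ <= _)%N; apply: eq_card => i; rewrite !inE /good.
by congr (~~ _); apply: eq_forallb => q; rewrite !len_flipw.
Qed.

(** Union bound over the sets [S] of segments; a set with more than [k] elements is no more likely
    since [tie_bound L a <= 1]. *)
Lemma prob_far_ties k G : admissible L r T cen G -> tie_bound L a <= 1 ->
  (rho [set w | far_family L r T cen k (fun i => near_tie L a (fstart L r T cen G i) w) G] <=
   ((2 ^ #|{: I}|)%:R * tie_bound L a ^+ k)%:E)%E.
Proof.
move=> adm tb1.
have tb0 : 0 <= tie_bound L a.
  by rewrite /tie_bound mulrn_wge0 // !mulr_ge0 ?normal_peak_ge0 // ltW.
pose F (S : {set I}) : set W := [set w | (far_set L r T cen G S && (k <= #|S|)%N) /\
  forall i, i \in S -> near_tie L a (fstart L r T cen G i) w].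
have mF S : measurable (F S).
  apply: measurableI; first by apply: measurable_boolset; exact: measurable_cst.
  by apply: measurable_forall => i; apply: measurable_imply; exact: measurable_near_tie.
have card2 : #|{: {set I}}| = (2 ^ #|{: I}|)%N by rewrite -cardsT -powersetT card_powerset cardsT.
rewrite EFinM -card2; apply: (measure_fin_union_le _ _ _ rho _ F) => //.
- by apply: measurable_far_family => i; exact: measurable_near_tie.
- by move=> w [S hS1 hS2]; exists S.
move=> S; have [/andP[fS kS]|no] := boolP (far_set L r T cen G S && (k <= #|S|)%N); last first.
  rewrite (_ : F S = set0) ?measure0 ?lee_fin ?exprn_ge0 //.
  by rewrite -subset0 => w [h _]; move: no; rewrite h.
pose s := [seq fstart L r T cen G i | i <- enum S].
have -> : F S = [set w | forall u, u \in s -> near_tie L a u w].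
  apply/seteqP; split => w.
    by move=> [_ h] u /mapP[i]; rewrite mem_enum => /h hi ->.
  move=> h; split; first by rewrite fS.
  by move=> i iS; apply: h; apply: map_f; rewrite mem_enum.
apply: (@le_trans _ _ (tie_bound L a ^+ size s)%:E).
  apply: near_tie_prob_far => //; rewrite pairwise_map.
  have : pairwise (fun i j => i != j) (enum S) by rewrite -uniq_pairwise enum_uniq.
  apply: (sub_in_pairwise (P := mem S)) => [i j iS jS ij|]; last by apply/allP => i; rewrite mem_enum.
  exact: implyP (forall_inP (forall_inP fS i iS) j jS) ij.
by rewrite lee_fin size_map -cardE ler_wiXn2l.
Qed.


Lemma unsat_flatten (c : ConfigSpace R) (G : family) :
  (forall t, unsat c.1 c.2 (wedges (cen t) (G t))) -> unsat c.1 c.2 (fedges L r T cen G).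
Proof. by move=> h; apply/allP => e /flattenP[_ /mapP[t _ ->]]; move/allP: (h t); apply. Qed.

(** One term for each case of the trichotomy. The sign flip term keeps the probability of few bad
    segments as a factor, because it is still to be summed over [G]; the other two are small
    uniformly in [G]. *)
Lemma prob_family_le k G : admissible L r T cen G -> tie_bound L a <= 1 ->
  (nu [set c : ConfigSpace R | unsat c.1 c.2 (fedges L r T cen G)] <=
   ((2 ^ size bd)%:R / 2 ^+ (r * L * #|T|))%:E * rho [set w | few_bad L r T cen (ncol L * k) w G] +
   ((2 ^ size bd)%:R * eps ^+ k + (2 ^ #|{: I}|)%:R * tie_bound L a ^+ k)%:E)%E.
Proof.
move=> adm tb1; set E := fedges L r T cen G.
have sE : {subset E <= eds C} by exact: fedges_eds.
pose D1 : set W := [set w | few_bad L r T cen (ncol L * k) w G].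
pose D2 : set W := [set w | far_family L r T cen k (fun i => near_tie L a (fstart L r T cen G i) w) G].
pose D3 : set W := [set w | far_family L r T cen k (fun i => shorter L r T cen a w G i) G].
have m1 : measurable D1 by exact: measurable_few_bad.
have m2 : measurable D2 by apply: measurable_far_family => i; exact: measurable_near_tie.
have m3 : measurable D3.
  by apply: (measurable_far_family k (fun i => [set w | shorter L r T cen a w G i])) => i; exact: measurable_shorter.
have mU (D : set W) : measurable D -> measurable [set c : ConfigSpace R | unsat c.1 c.2 E /\ D c.1].
  move=> mD; apply: measurableI; first exact: measurable_unsat_config.
  exact: (measurable_wfst_preimage D mD).
have hD1 P w : D1 (flipw P w) <-> D1 w by rewrite /D1 /= few_bad_flip.
have b1 := prob_unsat_flip nu iid C bd a eps hbd g drv low E D1 (uniq_fedges L r T cen sep G adm) sE m1 hD1.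
have b3 : (nu [set c : ConfigSpace R | unsat c.1 c.2 E /\ D3 c.1] <=
   ((2 ^ size bd)%:R * eps ^+ k)%:E)%E.
  apply: (prob_unsat_gain nu C bd a eps hbd g drv low) => // w [S /andP[fS kS] hS].
  have [f fC hf] := shorter_gain L r T cen C a inC w G S a0 adm fS hS.
  exists f => // s hs; apply: le_trans (hf s hs) _.
  by rewrite lerD2l lerN2 ler_pM2l ?mulr_gt0 // ler_nat.
have b2 := prob_far_ties k G adm tb1.
rewrite size_fedges in b1.
rewrite EFinD addeA; apply: le_trans (leeD (leeD b1 b3) b2).
apply: (@le_trans _ _ (nu (([set c : ConfigSpace R | unsat c.1 c.2 E /\ D1 c.1] `|`
    [set c : ConfigSpace R | unsat c.1 c.2 E /\ D3 c.1]) `|` @wfst R @^-1` D2))).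
  apply: le_measure; rewrite ?inE; first exact: measurable_unsat_config.
    by apply: measurableU; [apply: measurableU; exact: mU|exact: measurable_wfst_preimage].
  move=> c hc; have [h|h|h] := bad_trichotomy L r T cen a L0 sep c.1 G k adm.
  - by left; left.
  - by right.
  - by left; right.
apply: le_trans.
  by apply: measureU2; [apply: measurableU; exact: mU|exact: measurable_wfst_preimage].
by apply: leeD => //; apply: measureU2; exact: mU.
Qed.

Lemma measurable_cond_unsat (b : bool) E :
  measurable [set c : ConfigSpace R | b && unsat c.1 c.2 E].
Proof.
case: b; first exact: measurable_unsat_config.
rewrite (_ : [set c : ConfigSpace R | false && _] = set0) //.
by apply/seteqP; split.
Qed.

Definition unsat_path m (u : Z2) : set (ConfigSpace R) :=
  [set c | exists p : m.-tuple dir, saw u p && unsat c.1 c.2 (wedges u p)].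

(** Sum over admissible families. The probabilities of few bad segments add up to the expected
    number of such families, bounded by the count of codes; the other terms are paid once for every
    family. *)
Lemma prob_paths_le k : tie_bound L a <= 1 ->
  (nu [set c | forall t, unsat_path (r * L) (cen t) c] <=
   ((2 ^ size bd)%:R / 2 ^+ (r * L * #|T|) *
      (#|{: L.-tuple dir}| ^ (ncol L * k) * (1 + #|{: {ffun dir -> 'I_L.+1}}|) ^ #|{: I}|)%:R +
    #|{: family}|%:R * ((2 ^ size bd)%:R * eps ^+ k + (2 ^ #|{: I}|)%:R * tie_bound L a ^+ k))%:E)%E.
Proof.
move=> tb1; have tb0 : 0 <= tie_bound L a.
  by rewrite /tie_bound mulrn_wge0 // !mulr_ge0 ?normal_peak_ge0 // ltW.
pose F G : set (ConfigSpace R) := [set c | admissible L r T cen G && unsat c.1 c.2 (fedges L r T cen G)].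
have mF G : measurable (F G) by exact: measurable_cond_unsat.
have mP : measurable [set c : ConfigSpace R | forall t, unsat_path (r * L) (cen t) c].
  apply: measurable_forall => t; apply: measurable_exists => p.
  exact: measurable_cond_unsat.
apply: le_trans; first apply: (measure_fin_union _ _ _ nu _ F) => //.
  move=> c h; exists [ffun t => xchoose (h t)].
  have hx t := andP (xchooseP (h t)).
  apply/andP; split; first by apply/forallP => t; rewrite ffunE; case: (hx t).
  by apply: unsat_flatten => t; rewrite ffunE; case: (hx t).
rewrite (bigID (admissible L r T cen)) /= [X in (_ + X)%E]big1 ?adde0; last first.
  move=> G no; rewrite (_ : F G = set0) ?measure0 // -subset0 => c; rewrite /F /=.
  by rewrite (negbTE no).
set c1 := (2 ^ size bd)%:R / 2 ^+ (r * L * #|T|).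
set c2 : R := (2 ^ size bd)%:R * eps ^+ k + (2 ^ #|{: I}|)%:R * tie_bound L a ^+ k.
apply: (@le_trans _ _ (\sum_(G | admissible L r T cen G)
   (c1%:E * rho [set w | few_bad L r T cen (ncol L * k) w G] + c2%:E))%E).
  apply: lee_sum => G adm.
  have -> : F G = [set c | unsat c.1 c.2 (fedges L r T cen G)].
    by apply/seteqP; split => c; rewrite /F /= adm.
  exact: prob_family_le.
rewrite big_split /= [leRHS]EFinD; apply: leeD.
  rewrite -ge0_sume_distrr // [leRHS]EFinM; apply: lee_wpmul2l.
    by rewrite lee_fin divr_ge0 ?ler0n ?exprn_ge0.
  apply: sum_prob_le_card => [G|w]; first exact: measurable_few_bad.
  apply: leq_trans (card_few_bad L r T cen (ncol L * k) w).
  apply: subset_leq_card; apply/fintype.subsetP => G; rewrite !inE.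
  by move=> /andP[-> /asboolP].
have c20 : 0 <= c2 by rewrite addr_ge0 // mulr_ge0 ?ler0n ?exprn_ge0.
apply: (@le_trans _ _ (\sum_(G : family) c2%:E)%E); last by rewrite sume_const_card EFinM.
by rewrite [leRHS](bigID (admissible L r T cen)) /= leeDl // sume_ge0.
Qed.

End MainBound.

(** * Comparison of entropy and cost *)

Section Numerics.
Context {R : realType}.

Lemma card_words L : #|{: L.-tuple dir}| = (2 ^ (2 * L))%N.
Proof. by rewrite card_tuple card_prod card_bool expnM. Qed.

Lemma card_counts_le : (1 + #|{: {ffun dir -> 'I_65}}| <= 2 ^ 29)%N.
Proof.
have gen x n m : (x <= 2 ^ n)%N -> (0 < m)%N -> (1 + x ^ m <= 2 ^ (n * m).+1)%N.
  move=> xn m0; rewrite expnS mul2n -addnn leq_add ?expn_gt0 //.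
  by rewrite expnM leq_exp2r.
(* The four directions and [65 <= 2 ^ 7] give [2 ^ 28]; the summand 1 costs one more factor 2. *)
by rewrite card_ffun card_prod card_bool card_ord; exact: (gen 65 7 4)%N.
Qed.

(* With 64 steps per segment, the 2^(128 / 8) words allowed on a proportion 1/8
   of bad segments and the at most 2^29 displacement codes of the good ones are
   together far fewer than the 2^64 sign patterns; [tiny] absorbs all words. *)
Definition tiny : R := (2 ^- 130) ^+ (8 * ncol 64).

Lemma tiny_exp (y : R) k : 0 <= y -> y <= tiny -> y ^+ k <= 2 ^- (130 * (8 * ncol 64 * k)).
Proof.
move=> y0 yt; apply: (@le_trans _ _ (tiny ^+ k)); first by rewrite lerXn2r // nnegrE (le_trans y0).
by rewrite /tiny !exprVn -!exprM !mulnA.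
Qed.

Lemma three_terms_le (A P v K e q t u : R) : 1 <= A -> 0 <= u -> v * K <= u -> P * e <= u ->
  P * (q * t) <= u -> A * v * K + P * (A * e + q * t) <= 3 * A * u.
Proof.
move=> A1 u0 c1 c2 c3; have A0 := le_trans ler01 A1.
have := ler_wpM2l A0 c1; have := ler_wpM2l A0 c2; have := ler_peMl u0 A1.
by rewrite mulrDr; lra.
Qed.

(** Here [N] is the number of segments, of which at most [ncol 64 * k], that is [N / 8], are bad. Up
    to the perimeter factor [2 ^ b], each of the three terms is at most [2 ^- N]. *)
Lemma weights_le (b k N : nat) (eps tb : R) : N = (8 * ncol 64 * k)%N ->
  0 <= eps -> eps <= tiny -> 0 <= tb -> tb <= tiny ->
  (2 ^ b)%:R / 2 ^+ (64 * N) *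
    (#|{: 64.-tuple dir}| ^ (ncol 64 * k) * (1 + #|{: {ffun dir -> 'I_65}}|) ^ N)%:R +
  (2 ^ (128 * N))%:R * ((2 ^ b)%:R * eps ^+ k + (2 ^ N)%:R * tb ^+ k) <=
  3 * (2 ^ b)%:R / 2 ^+ N :> R.
Proof.
move=> NE e0 et t0 tt.
have p2 n : 0 < 2 ^+ n :> R by rewrite exprn_gt0.
have b1 : 1 <= (2 ^ b)%:R :> R by rewrite ler1n expn_gt0.
have V n m : (n <= m)%N -> 2 ^- m <= 2 ^- n :> R.
  by move=> nm; rewrite lef_pV2 ?posrE // ler_eXn2l // ltr1n.
have E n m : (n <= m)%N -> 2 ^+ n * 2 ^- m = 2 ^- (m - n) :> R.
  by move=> nm; rewrite -[m in LHS](subnK nm) exprD invfM mulrC -mulrA mulVf ?mulr1 // gt_eqF.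
have h1 : 2 ^- (64 * N) * (#|{: 64.-tuple dir}| ^ (ncol 64 * k) * (1 + #|{: {ffun dir -> 'I_65}}|) ^ N)%:R <= 2 ^- N :> R.
  (* The [2 ^ 128] words on [N / 8] bad segments give [2 ^ (16 * N)], and the codes give
     [2 ^ (29 * N)]. *)
  have : (#|{: 64.-tuple dir}| ^ (ncol 64 * k) * (1 + #|{: {ffun dir -> 'I_65}}|) ^ N <= 2 ^ (45 * N))%N.
    rewrite card_words -expnM.
    apply: (@leq_trans (2 ^ (16 * N) * (2 ^ 29) ^ N)).
      apply: leq_mul; last by case: N {NE} => [//|N]; rewrite leq_exp2r // card_counts_le.
      by rewrite leq_exp2l // NE; lia.
    by rewrite -expnM -expnD leq_exp2l //; lia.
  rewrite -(ler_nat R) => /(ler_wpM2l (ltW (_ : 0 < 2 ^- (64 * N)))) => /(_ _) le.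
  apply: le_trans (le _) _; first by rewrite invr_gt0.
  by rewrite natrX mulrC E; [apply: V|]; lia.
(* There are [2 ^ (128 * N)] families and [2 ^ N] sets of segments, against
   [tiny ^+ k = 2 ^- (130 * N)]. *)
have h2 y : 0 <= y -> y <= tiny -> (2 ^ (128 * N))%:R * ((2 ^ N)%:R * y ^+ k) <= 2 ^- N :> R.
  move=> y0 yt; rewrite !natrX mulrA -exprD.
  apply: (@le_trans _ _ (2 ^+ (128 * N + N) * 2 ^- (130 * N))).
    by rewrite ler_pM2l // NE; exact: tiny_exp.
  by rewrite E; [apply: V|]; lia.
have h3 : (2 ^ (128 * N))%:R * eps ^+ k <= 2 ^- N.
  apply: le_trans (h2 _ e0 et); rewrite ler_pM2l ?ltr0n ?expn_gt0 //.
  by rewrite ler_peMl ?exprn_ge0 // ler1n expn_gt0.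
apply: three_terms_le => //; last exact: h2.
Qed.

End Numerics.

(** * Infinite clusters and translation invariance *)

Section InfiniteClusters.
Context {R : realType}.
Implicit Types (c : Config R) (u v : Z2) (p : seq dir).

Lemma unsat_cat c (E E' : seq edge) : unsat c.1 c.2 (E ++ E') = unsat c.1 c.2 E && unsat c.1 c.2 E'.
Proof. exact: all_cat. Qed.

Lemma unsat_conn_path c u v : unsat_conn R c u v ->
  exists p, unsat c.1 c.2 (wedges u p) /\ wend u p = v.
Proof.
elim => [x y [z [d [hU hz]]]|x|x y z _ [p [hp ep]] _ [q [hq eq]]].
- have hJ : J c.1 c.2 (z, d) < 0 by exact: hU.
  case: hz => -[-> ->].
    by exists [:: (d, false)]; rewrite /unsat /= andbT.
  exists [:: (d, true)]; rewrite /unsat /= andbT.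
  have -> : dstep (dual_other_end z d) (d, true) = z.
    case: z d {hU hJ} => x1 x2 [];
    by rewrite /dstep /dual_other_end /vadd /=; congr pair; lia.
  by rewrite /dedge /=; have -> : dstep (dual_other_end z d) (d, true) = z;
    [case: z d {hU hJ} => x1 x2 [];
    rewrite /dstep /dual_other_end /vadd /=; congr pair; lia|].
- by exists [::].
- by exists (p ++ q); rewrite wedges_cat wend_cat unsat_cat ep hp hq.
Qed.

Lemma nth_wpos u p i : (i <= size p)%N -> nth u (u :: wpos u p) i = wend u (take i p).
Proof.
elim: p u i => [|s p IH] u [|i] //= ip.
by rewrite -/(wend _ _) -IH // /wpos; apply: set_nth_default; rewrite /= size_scanl.
Qed.

(** Loop erasure by induction on the length: the piece between two visits to the same vertex is cut
    out. *)
Lemma unsat_saw c u p : unsat c.1 c.2 (wedges u p) ->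
  exists q, [/\ unsat c.1 c.2 (wedges u q), wend u q = wend u p & saw u q].
Proof.
have [n] := ubnP (size p); elim: n p => // n IH p; rewrite ltnS => pn hp.
have [sp|/(uniqPn u)[i [j [ij js e]]]] := boolP (saw u p); first by exists p.
rewrite /= /wpos size_scanl ltnS in js.
have ip : (i <= size p)%N by rewrite ltnW // (leq_trans ij).
rewrite !nth_wpos // in e.
have E : wend u (take i p ++ drop j p) = wend u p.
  by rewrite wend_cat e -wend_cat cat_take_drop.
rewrite -E; apply: IH.
  rewrite size_cat size_takel // size_drop; apply: leq_trans pn.
  by rewrite addnBA // ltn_subLR; [lia|exact: leq_trans (leq_addl _ _)].
move: hp; rewrite -{1}(cat_take_drop j p) wedges_cat unsat_cat => /andP[hj hd].
rewrite wedges_cat unsat_cat e hd andbT.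
move: hj; rewrite -{1}(cat_take_drop i (take j p)) wedges_cat unsat_cat => /andP[].
by rewrite take_takel // ltnW.
Qed.

Lemma finite_near m u : finite_set [set v | near m u v].
Proof.
pose f (ij : 'I_(2 * m).+1 * 'I_(2 * m).+1) : Z2 :=
  (u.1 - m%:Z + ij.1%:Z, u.2 - m%:Z + ij.2%:Z).
apply: (@sub_finite_set _ _ (range f)); last exact: finite_image.
case=> x y; rewrite /near /= => h.
have hx : (absz (x - (u.1 - m%:Z))%R < (2 * m).+1)%N by lia.
have hy : (absz (y - (u.2 - m%:Z))%R < (2 * m).+1)%N by lia.
exists (Ordinal hx, Ordinal hy) => //; rewrite /f /=; congr pair; lia.
Qed.

(** Without a self-avoiding unsatisfied walk of [m] steps, loop erasure reaches the whole cluster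
    within [m] steps, and the cluster lies in a finite ball. *)
Lemma infinite_cluster_path c u : ~ finite_set [set v | unsat_conn R c u v] ->
  forall m, unsat_path m u c.
Proof.
move=> inf m; apply: contrapT => no; apply: inf.
apply: (sub_finite_set _ (finite_near m u)) => v /unsat_conn_path[p [hp <-]].
have [q [hq <- sq]] := unsat_saw _ _ _ hp.
have [le|lt] := leqP (size q) m; first exact: near_leq le (wend_near u q).
case: no; have sz : size (take m q) == m by rewrite size_takel // ltnW.
exists (Tuple sz) => /=.
move: hq sq; rewrite -{1 2}(cat_take_drop m q) wedges_cat unsat_cat => /andP[-> _].
by case/saw_cat=> ->.
Qed.

End InfiniteClusters.

Definition origin : Z2 := (0, 0).

Section Translation.
Context {R : realType}.
Variable nu : probability (ConfigSpace R) R.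
Hypothesis ti : translation_invariant R nu.

Lemma vaddC : commutative vadd.
Proof. by move=> [a b] [c d]; rewrite /vadd /= addrC [b + d]addrC. Qed.

Lemma vaddA : associative vadd.
Proof. by move=> [a b] [c d] [e f]; rewrite /vadd /= !addrA. Qed.

Lemma vaddAC : right_commutative vadd.
Proof. by move=> x y z; rewrite -!vaddA [vadd y z]vaddC. Qed.

Lemma dstep_vadd x u s : dstep (vadd x u) s = vadd (dstep x s) u.
Proof. by rewrite /dstep /dual_other_end; case: s => [[] []] /=; exact: vaddAC. Qed.

Lemma wpos_vadd x u p : wpos (vadd x u) p = map (vadd ^~ u) (wpos x p).
Proof. by elim: p x => //= s p IH x; rewrite dstep_vadd IH. Qed.

Lemma wedges_vadd x u p : wedges (vadd x u) p = [seq (vadd e.1 u, e.2) | e : edge <- wedges x p].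
Proof.
elim: p x => //= s p IH x; rewrite dstep_vadd IH; congr cons.
by rewrite /dedge dstep_vadd /=; case: ifP.
Qed.

Lemma saw_vadd x u p : saw (vadd x u) p = saw x p.
Proof.
rewrite /saw wpos_vadd -[_ :: _]/(map (vadd ^~ u) (x :: wpos x p)) map_inj_uniq // => -[a b] [c d] [].
by move=> /addIr -> /addIr ->.
Qed.

Lemma unsat_shift (c : Config R) u E :
  unsat (Defs.shift R u c).1 (Defs.shift R u c).2 E =
  unsat c.1 c.2 [seq (vadd e.1 u, e.2) | e : edge <- E].
Proof.
rewrite /unsat all_map; apply: eq_all => e; rewrite /= /J /Defs.shift /=.
by rewrite /edge_end vaddAC.
Qed.

Lemma measurable_unsat_path m u : measurable (unsat_path m u : set (ConfigSpace R)).
Proof. by apply: measurable_exists => p; exact: measurable_cond_unsat. Qed.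

Lemma unsat_path_shift m u :
  Defs.shift R u @^-1` (unsat_path m origin) = unsat_path m u.
Proof.
have u0 : vadd origin u = u by case: u => x y; rewrite /origin /vadd /= !add0r.
have H c (p : m.-tuple dir) : saw origin p &&
    unsat (Defs.shift R u c).1 (Defs.shift R u c).2 (wedges origin p) =
    saw u p && unsat c.1 c.2 (wedges u p).
  by rewrite unsat_shift -wedges_vadd -(saw_vadd _ u) u0.
by apply/seteqP; split => c [p]; [rewrite H|rewrite -H] => h; exists p.
Qed.

(** A measurable event containing the event that the cluster of [u] is infinite. *)
Definition long_paths u : set (ConfigSpace R) := [set c | forall m, unsat_path m u c].

Lemma measurable_long_paths u : measurable (long_paths u).
Proof.
rewrite (_ : long_paths u = \bigcap_m unsat_path m u).
  by apply: bigcapT_measurable => m; exact: measurable_unsat_path.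
by apply/seteqP; split => c h m //; exact: h.
Qed.

Lemma prob_long_paths u : nu (long_paths u) = nu (long_paths origin).
Proof.
rewrite -(ti u (long_paths origin)); last exact: measurable_long_paths.
congr (nu _); apply/seteqP; split => c h m; have := h m; rewrite -(unsat_path_shift m u); exact.
Qed.

Lemma prob_unsat_path_ge m u : (nu (long_paths origin) <= nu (unsat_path m u))%E.
Proof.
rewrite -(prob_long_paths u); apply: le_measure; rewrite ?inE.
- exact: measurable_long_paths.
- exact: measurable_unsat_path.
- by move=> c; exact.
Qed.

(** By translation invariance the event is null at every one of the countably many dual vertices. *)
Lemma null_long_paths : nu (long_paths origin) = 0%E ->
  {ae nu, forall c : ConfigSpace R, all_unsat_clusters_finite R c}.
Proof.
move=> n0; pose N (n : nat) := if unpickle n is Some u then long_paths u else set0.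
have neg n : nu.-negligible (N n).
  rewrite /N; case: unpickle => [u|]; last exact: negligible_set0.
  exists (long_paths u); split => //; first exact: measurable_long_paths.
  by rewrite prob_long_paths.
apply: negligibleS (negligible_bigcup neg) => c /= /existsNP[u inf].
by exists (pickle u) => //; rewrite /N pickleK; exact: infinite_cluster_path.
Qed.

End Translation.

(** * The large square, its boundary and the boxes inside it *)

Definition grid (n : nat) : seq Z2 := [seq (Posz i, Posz j) | i <- iota 0 n, j <- iota 0 n].

Definition grid_boundary (n : nat) : seq Z2 :=
  [seq (-1, Posz i) | i <- iota 0 n] ++ [seq (Posz n, Posz i) | i <- iota 0 n] ++
  [seq (Posz i, -1) | i <- iota 0 n] ++ [seq (Posz i, Posz n) | i <- iota 0 n].

Lemma mem_grid n (x : Z2) : (x \in grid n) = (0 <= x.1 < n%:Z) && (0 <= x.2 < n%:Z).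
Proof.
case: x => a b; apply/allpairsP/idP => /= [[[i j] /= [hi hj [-> ->]]]|h].
  by move: hi hj; rewrite !mem_iota; lia.
exists (absz a, absz b); rewrite !mem_iota /=; split; [lia|lia|congr pair; lia].
Qed.

Lemma size_grid_boundary n : size (grid_boundary n) = (4 * n)%N.
Proof. by rewrite /grid_boundary !size_cat !size_map !size_iota; lia. Qed.

Lemma grid_boundary_out n x : x \in grid_boundary n -> x \notin grid n.
Proof.
rewrite mem_grid !mem_cat => /or4P[] /mapP[i]; rewrite mem_iota => hi -> /=; lia.
Qed.

Lemma grid_neighbours n x : x \in Cbar (grid n) -> x \notin grid n -> x \in grid_boundary n.
Proof.
rewrite mem_undup mem_cat => /orP[->//|/flattenP[_ /mapP[[a b] hab ->] hx]].
have side i : (0 <= i < n%:Z) -> absz i \in iota 0 n by rewrite mem_iota; lia.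
move: hab hx; rewrite mem_grid mem_grid !mem_cat !inE /vadd /= => /andP[ha hb].
move=> /or4P[] /eqP-> /= nx; apply/or4P.
- apply: Or42; apply/mapP; exists (absz b); first exact: side.
  congr pair; lia.
- apply: Or41; apply/mapP; exists (absz b); first exact: side.
  congr pair; lia.
- apply: Or44; apply/mapP; exists (absz a); first exact: side.
  congr pair; lia.
- apply: Or43; apply/mapP; exists (absz a); first exact: side.
  congr pair; lia.
Qed.

Section Boxes.
Variables (m s K : nat).

(** The spacing [2 * m + 1] keeps walks of [m] steps from different centres apart; the offset
    [m + s] leaves room at the border for competing segments of [s] steps. *)
Definition center (t : 'I_K * 'I_K) : Z2 :=
  ((t.1 * (2 * m).+1 + m + s)%N%:Z, (t.2 * (2 * m).+1 + m + s)%N%:Z).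

Definition side : nat := (K * (2 * m).+1 + 2 * (m + s))%N.

Lemma center_sep t t' : t != t' -> ~~ near (m + m) (center t) (center t').
Proof.
case: t t' => [[i hi] [j hj]] [[i' hi'] [j' hj']]; apply: contra => /andP[]; rewrite /center /= => h1 h2.
have far (x y : nat) : (`|(x * (2 * m).+1 + m + s)%N%:Z - (y * (2 * m).+1 + m + s)%N%:Z| <= (m + m)%N%:Z) -> x = y.
  by move=> h; case: (ltngtP x y) => // lt; exfalso; move: h lt; nia.
by apply/eqP; congr pair; apply/val_inj => /=; apply/esym/far.
Qed.

Lemma center_in t x : near (m + s) (center t) x -> x \in grid side.
Proof.
case: t => [[i hi] [j hj]]; rewrite mem_grid /near /center /side /= => /andP[h1 h2].
have b (y : nat) : (y < K)%N -> (y * (2 * m).+1 + (2 * m).+1 <= K * (2 * m).+1)%N by nia.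
have := b i hi; have := b j hj; move: h1 h2; move: (i * _)%N (j * _)%N (K * _)%N; lia.
Qed.

End Boxes.

(** Outside [B] at most [n] events occur, so their expected number exceeds [n] by at most [#|I|]
    times the probability of [B]. *)
Lemma reverse_markov d (T : measurableType d) (R : realType) (mu : probability T R)
    (I : finType) (D : I -> set T) (B : set T) (n : nat) :
  (forall i, measurable (D i)) -> measurable B ->
  (forall t, ~ B t -> (#|[pred i | `[< D i t >]]| <= n)%N) ->
  (\sum_i mu (D i) <= n%:R%:E + #|I|%:R%:E * mu B)%E.
Proof.
move=> mD mB le; rewrite -sume_const_card.
apply: (@le_trans _ _ (\sum_i (mu (D i `\` B) + mu B))%E).
  apply: lee_sum => i _; apply: (@le_trans _ _ (mu ((D i `\` B) `|` B))); last first.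
    by apply: measureU2 => //; exact: measurableD.
  apply: le_measure; rewrite ?inE //; first by apply: measurableU => //; exact: measurableD.
  by move=> t Dt; have [Bt|nB] := pselect (B t); [right|left].
rewrite big_split /=; apply: leeD => //.
apply: (sum_prob_le_card _ T R mu I predT (fun i => D i `\` B)) => [i|t]; first exact: measurableD.
have [Bt|nB] := pselect (B t).
  rewrite eq_card0 // => i; rewrite !inE /=; apply/negP => /asboolP[_]; exact.
apply: leq_trans (le t nB); apply: subset_leq_card; apply/fintype.subsetP => i.
by rewrite !inE /= => -[].
Qed.

Lemma three_pow_le (R : realType) n p k m : (n + p + k <= m)%N ->
  2 ^+ n * (3 * 2 ^+ p / 2 ^+ m) <= 3 * 2 ^- k :> R.
Proof.
move=> le; have -> : 2 ^+ n * (3 * 2 ^+ p / 2 ^+ m) = 3 * (2 ^+ (n + p) / 2 ^+ m) :> R.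
  by rewrite exprD; ring.
rewrite ler_pM2l // ler_pdivrMr ?exprn_gt0 // mulrC ler_pdivlMr ?exprn_gt0 //.
by rewrite -exprD ler_eXn2l ?ltr1n.
Qed.

(** * Perimeter against area: infinite clusters have probability zero *)

Section NoPercolation.
Context {R : realType}.
Variable nu : probability (ConfigSpace R) R.
Hypothesis ti : translation_invariant R nu.
Hypothesis iid : iid_couplings (distribution nu (@wfst R)).
Variables (a eps : R).
Hypotheses (a0 : 0 < a) (tb : tie_bound 64 a <= tiny (R := R)).
Hypotheses (e0 : 0 <= eps) (et : eps <= tiny).
Hypothesis kernel : forall n, exists2 g,
  driven nu (grid n) (grid_boundary n) g & low_temp (grid n) a eps g.

Lemma tiny_gt0 : 0 < tiny (R := R).
Proof. by rewrite /tiny exprn_gt0 // invr_gt0 exprn_gt0. Qed.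

Lemma tiny_le1 : tiny (R := R) <= 1.
Proof.
rewrite /tiny exprn_ile1 //.
by rewrite invf_le1 ?exprn_gt0 // exprn_ege1 // ler1n.
Qed.

(** The number of segments per path is a multiple of [8 * ncol 64], so that for [#|G|] paths the
    threshold [k = #|G| * r'] is an exact fraction of all segments. *)
Definition blocks (r' : nat) : nat := (8 * ncol 64 * r')%N.

Lemma prob_paths_set r' K m (G : {set 'I_K * 'I_K}) : m = (blocks r' * 64)%N ->
  (nu [set c | forall t, t \in G -> unsat_path m (center m 64 K t) c] <=
   (3 * (2 ^ (4 * side m 64 K))%:R / 2 ^+ (8 * ncol 64 * (#|G| * r')))%:E)%E.
Proof.
move=> mE; have [g drv low] := kernel (side m 64 K).
pose T := {t : 'I_K * 'I_K | t \in G}; pose cen (t : T) := center m 64 K (val t).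
have sep t t' : t != t' -> ~~ near (blocks r' * 64 + blocks r' * 64) (cen t) (cen t').
  by move=> ne; rewrite -mE; apply: center_sep; rewrite (inj_eq val_inj).
have inC (t : T) x : near (blocks r' * 64 + 64) (cen t) x -> x \in grid (side m 64 K).
  by rewrite -mE; exact: center_in.
have tb1 := le_trans tb tiny_le1.
have tb0 : 0 <= tie_bound 64 a.
  by rewrite /tie_bound mulrn_wge0 // !mulr_ge0 ?normal_peak_ge0 // ltW.
have cT : #|{: T}| = #|G| by rewrite card_sig.
have := prob_paths_le nu iid _ _ a eps (@grid_neighbours (side m 64 K)) g drv low a0 e0
  64 (blocks r') T cen isT sep inC (#|G| * r')%N tb1.
have -> : [set c : ConfigSpace R | forall t : T, unsat_path (blocks r' * 64) (cen t) c] =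
    [set c | forall t, t \in G -> unsat_path m (center m 64 K t) c].
  rewrite -mE; apply/seteqP; split => c h t; last by apply: h; exact: valP.
  by move=> tG; exact: (h (exist _ t tG)).
move=> le; apply: le_trans le _; rewrite lee_fin.
have NE : #|{: T * 'I_(blocks r')}| = (8 * ncol 64 * (#|G| * r'))%N.
  by rewrite card_prod card_ord cT /blocks mulnCA.
have -> : #|{: {ffun T -> (blocks r' * 64).-tuple dir}}| =
    (2 ^ (128 * #|{: T * 'I_(blocks r')}|))%N.
  rewrite card_ffun card_words -expnM card_prod card_ord; congr (2 ^ _)%N.
  have aux x y : (2 * (x * 64) * y = 128 * (y * x))%N by nia.
  exact: aux.
have -> : (blocks r' * 64 * #|{: T}|)%N = (64 * #|{: T * 'I_(blocks r')}|)%N.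
  by rewrite card_prod card_ord mulnAC mulnC (mulnC (blocks r')).
by rewrite size_grid_boundary -NE; exact: weights_le.
Qed.

Lemma long_paths_null : nu (long_paths origin) = 0%E.
Proof.
set p := nu _; have pfin : p \is a fin_num by exact: (fin_num_measure nu _ (measurable_long_paths _)).
apply/eqP; rewrite -(fineK pfin) eqe; set q := fine p.
have q0 : 0 <= q by rewrite fine_ge0 //; exact: measure_ge0.
rewrite eq_le q0 andbT leNgt; apply/negP => qp.
(* Paths of length proportional to [1 / q] compensate for the density: a fraction [q / 2] of the
   centres then carries a number of segments comparable to [K * K]. *)
have [r' hr'] : exists r' : nat, 1 <= r'%:R * q.
  exists (Num.bound q^-1); rewrite -ler_pdivrMr // div1r.
  by apply/ltW/archi_boundP; rewrite invr_ge0.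
have [m mE] : exists m, m = (blocks r' * 64)%N by exists (blocks r' * 64)%N.
(* For fixed [m] the perimeter is linear in [K], so the area [K * K] wins; [6 / q < K] serves the
   final contradiction. *)
have [K [K0 hK6 hKm]] : exists K, [/\ (0 < K)%N, 6 / q < K%:R & (4 * side m 64 K <= K * K)%N].
  exists ((4 * (2 * m).+1 + 8 * (m + 64)) + Num.bound (6 / q)).+1%N; split => //.
    apply: lt_trans (archi_boundP _) _; first by rewrite divr_ge0.
    by rewrite ltr_nat ltnS leq_addl.
  by rewrite /side; move: (2 * m).+1 (m + 64)%N (Num.bound _) => x y z; nia.
pose P t := unsat_path m (center m 64 K t) : set (ConfigSpace R).
have mP t : measurable (P t) by exact: measurable_unsat_path.
(* The expected number of centres starting an unsatisfied path is at least [q * K * K]; [h] is half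
   of this bound, rounded down. *)
have [h h1 h2] : exists2 h : nat, h%:R <= q / 2 * (K * K)%:R & q / 2 * (K * K)%:R < h.+1%:R.
  exists (Num.truncn (q / 2 * (K * K)%:R)); last exact: truncnS_gt.
  by rewrite truncn_le // !mulr_ge0 ?invr_ge0 ?ler0n.
pose B : set (ConfigSpace R) := [set c | exists G : {set 'I_K * 'I_K},
  (h < #|G|)%N /\ forall t, t \in G -> P t c].
pose F (G : {set 'I_K * 'I_K}) : set (ConfigSpace R) :=
  [set c | (h < #|G|)%N /\ forall t, t \in G -> P t c].
have mP' (G : {set 'I_K * 'I_K}) : measurable [set c : ConfigSpace R | forall t, t \in G -> P t c].
  by apply: measurable_forall => t; apply: measurable_imply.
have mF G : measurable (F G).
  rewrite /F; case: (h < #|G|)%N.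
    rewrite (_ : [set c | _ /\ _] = [set c : ConfigSpace R | forall t, t \in G -> P t c]) //.
    by apply/seteqP; split => c /=; [case|].
  rewrite (_ : [set c | _ /\ _] = (set0 : set (ConfigSpace R))) // -subset0 => c [] //.
have mB : measurable B by exact: measurable_exists.
pose b : R := 3 * (2 ^ (4 * side m 64 K))%:R / 2 ^+ (4 * (K * K)).
have nuF G : (nu (F G) <= b%:E)%E.
  have [hG|hG] := ltnP h #|G|; last first.
    have -> : F G = set0.
      by rewrite -subset0 => c [hc _]; move: hc; rewrite ltnNge hG.
    by rewrite measure0 lee_fin /b; apply: divr_ge0; [rewrite mulr_ge0 ?ler0n|rewrite exprn_ge0].
  apply: (@le_trans _ _ (nu [set c | forall t, t \in G -> P t c])).
    by apply: le_measure; rewrite ?inE // => c [].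
  apply: le_trans; first exact: (prob_paths_set r' K m G mE).
  rewrite lee_fin ler_wpM2l ?mulr_ge0 ?ler0n // lef_pV2 ?posrE ?exprn_gt0 // ler_eXn2l ?ltr1n //.
  (* At least [q / 2 * K * K] centres and [r' >= 1 / q] give half of [K * K]; the factor 8 then
     produces the exponent [4 * (K * K)] of [b]. *)
  have KG : (K * K <= 2 * (#|G| * r'))%N.
    have hG' : q / 2 * (K * K)%:R <= #|G|%:R.
      by apply: le_trans (ltW h2) _; rewrite ler_nat.
    have r0 : 0 <= r'%:R :> R by rewrite ler0n.
    have kk : 0 <= (K * K)%:R :> R by rewrite ler0n.
    rewrite -(ler_nat R) (natrM _ 2) (natrM _ #|G|).
    have := ler_wpM2r kk hr'; have := ler_wpM2r r0 hG'.
    by move: (K * K)%:R #|G|%:R r'%:R => x y z; lra.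
  have n0 : (0 < ncol 64)%N by rewrite /ncol !muln_gt0.
  move: (ncol 64) (#|G| * r')%N (K * K)%N n0 KG => x y z x0 zy.
  by have := leq_pmull y x0; lia.
(* The exponent [4 * (K * K)] absorbs the [2 ^ (K * K)] choices of the set of centres and the
   boundary conditions, and leaves [2 ^- K]. *)
have nuB : (nu B <= (3 * 2 ^- K)%:E)%E.
  apply: le_trans; first exact: (measure_fin_union_le _ _ _ nu _ F B b%:E).
  have -> : #|{: {set 'I_K * 'I_K}}| = (2 ^ (K * K))%N.
    by rewrite -cardsT -powersetT card_powerset cardsT card_prod card_ord.
  rewrite -EFinM lee_fin /b !natrX; apply: three_pow_le.
  have aux y z : (0 < z)%N -> (4 * y <= z * z)%N -> (z * z + 4 * y + z <= 4 * (z * z))%N.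
    by move=> z0 le; have := leq_pmulr z z0; lia.
  exact: aux.
have le : (\sum_t nu (P t) <= h%:R%:E + #|{: 'I_K * 'I_K}|%:R%:E * nu B)%E.
  apply: reverse_markov => // c nB; rewrite leqNgt; apply/negP => lt; apply: nB.
  exists [set t | `[< P t c >]]%SET; split; first by rewrite cardsE.
  by move=> t; rewrite inE => /asboolP.
have KK : #|{: 'I_K * 'I_K}| = (K * K)%N by rewrite card_prod card_ord.
have ge : (((K * K)%:R * q)%:E <= h%:R%:E + ((K * K)%:R * (3 * 2 ^- K))%:E)%E.
  apply: (@le_trans _ _ (\sum_t nu (P t))%E).
    rewrite EFinM -KK -sume_const_card; apply: lee_sum => t _.
    by rewrite /q fineK //; exact: prob_unsat_path_ge.
  apply: le_trans le _; apply: leeD => //; rewrite KK EFinM; apply: lee_wpmul2l => //.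
move: ge; rewrite -EFinD lee_fin => ge.
have kk : 0 < (K * K)%:R :> R by rewrite ltr0n muln_gt0 K0.
have : q <= q / 2 + 3 * 2 ^- K.
  rewrite -(ler_pM2l kk) mulrDr; apply: le_trans ge _.
  by rewrite lerD2r mulrC.
(* The bound just obtained is contradicted by [6 / q < K < 2 ^ K]. *)
have : 3 * 2 ^- K < q / 2; last by lra.
have K2 : K%:R < 2 ^+ K :> R by rewrite -natrX ltr_nat ltn_expl.
rewrite ltr_pdivrMr ?exprn_gt0 //.
have : 6 < q * K%:R by rewrite mulrC -ltr_pdivrMr.
have := ltr_pM2l qp K%:R (2 ^+ K); rewrite K2.
lra.
Qed.

End NoPercolation.

Lemma expR_le_of_large (R : realType) (t a beta : R) : 0 < t -> 0 < a ->
  - ln t / (2 * a) < beta -> expR (- (2 * beta * a)) <= t.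
Proof.
move=> t0 a0; rewrite ltr_pdivrMr ?mulr_gt0 // => h.
by rewrite -[leRHS]lnK ?posrE // ler_expR; lra.
Qed.

Lemma small_tie_bound (R : realType) L (t : R) : 0 < t -> exists2 a, 0 < a & tie_bound L a <= t.
Proof.
move=> t0; pose n : R := #|{: L.-tuple dir * L.-tuple dir}|%:R.
have q0 : 0 <= normal_peak 1 * 4 * n by rewrite !mulr_ge0 ?normal_peak_ge0 ?ler0n.
have q1 : 0 < normal_peak 1 * 4 * n + 1 by rewrite ltr_wpDl.
exists (t / (normal_peak 1 * 4 * n + 1)); first by rewrite divr_gt0.
rewrite /tie_bound -mulr_natr -/n; set d := _ + 1.
have -> : normal_peak 1 * (4 * (t / d)) * n = t * (normal_peak 1 * 4 * n) / d by ring.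
by rewrite ler_pdivrMr // ler_pM2l // /d lerDl.
Qed.

Theorem theorem1p4 (R : realType) :
  exists beta_star : R,
    (forall (beta : R), 0 <= beta -> beta_star < beta ->
       forall nu : probability (ConfigSpace R) R,
         EA_spin_glass R beta nu -> translation_invariant R nu ->
         {ae nu, forall c : ConfigSpace R, all_unsat_clusters_finite R c})
    /\
    (forall nu : probability (ConfigSpace R) R,
       ground_state R nu -> translation_invariant R nu ->
       {ae nu, forall c : ConfigSpace R, all_unsat_clusters_finite R c}).
Proof.
(* The margin [a] is fixed first, to make near ties rare; [beta_star] is then such that
   [exp (- 2 * beta * a)] is at most [tiny] beyond it. *)
have [a a0 tb] := small_tie_bound R 64 tiny tiny_gt0.
exists (- ln tiny / (2 * a)); split.
  move=> beta b0 hb nu ea ti; apply: null_long_paths => //.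
  apply: (long_paths_null nu ti (iid_couplings_marginal nu ea.1) a (expR (- (2 * beta * a)))) => //.
    exact: expR_le_of_large tiny_gt0 a0 hb.
  move=> n; exists (gibbs R beta (grid n)); last exact: gibbs_low_temp.
  by apply: EA_driven ea; [exact: grid_neighbours|exact: grid_boundary_out].
move=> nu gs ti; apply: null_long_paths => //.
(* For ground states [eps] is 0, the limit of [exp (- 2 * beta * a)] at infinite [beta]. *)
apply: (long_paths_null nu ti (iid_couplings_marginal nu gs.1) a 0) => //; first exact/ltW/tiny_gt0.
move=> n; exists (ground (grid n)); last exact: ground_low_temp.
by apply: ground_driven gs; exact: grid_neighbours.
Qed.
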